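(* (a) For every fixed $\eta>0$ there are constants $c_\eta,C>0$ such that for all sufficiently large $n$ and all $\epsilon$ with $0\le \epsilon\le \frac14-\eta$ we have $c_\eta n\le P(n,\epsilon,2)\le Cn$; that is, $P(n,\epsilon,2)=\Theta(n)$ for $\epsilon<1/4$ bounded away from $1/4$. (b) For $n^{-1/2}\le \epsilon\le \epsilon_0$, where $\epsilon_0>0$ is a suitable absolute constant, $P(n,\epsilon,3)=\Theta(1/\epsilon^2)$, i.e. $c/\epsilon^2\le P(n,\epsilon,3)\le C/\epsilon^2$ for absolute constants $c,C>0$. (c) For $n^{-1}\le \epsilon\le \epsilon_0$, where $\epsilon_0>0$ is a suitable absolute constant, $P(n,\epsilon,4)=\Theta(1/\epsilon)$, i.e. $c/\epsilon\le P(n,\epsilon,4)\le C/\epsilon$ for absolute constants $c,C>0$.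
   Context: Graphs are finite and simple. The distance between two vertices is the length of a shortest path between them; the diameter of a connected graph is the maximum distance between two of its vertices, and a disconnected graph has diameter $\infty$. For an edge subset $E'\subseteq E$ of a graph $G=(V,E)$, the diameter of $E'$ is the diameter of the graph with edge set $E'$ whose vertex set is the set of vertices of $G$ lying in at least one edge of $E'$. $P(n,\epsilon,d)$ denotes the smallest $\ell$ such that every graph $G=(V,E)$ on $n$ vertices has an edge partition $E=E_0\cup E_1\cup\cdots\cup E_\ell$ with $|E_0|\le \epsilon n^2$ and the diameter of $E_i$ at most $d$ for $1\le i\le \ell$. *)

(* Defs.v *)
From mathcomp Require Import all_boot all_order all_algebra.
From mathcomp Require Import boolp reals.
Set Implicit Arguments.
Unset Strict Implicit.
Unset Printing Implicit Defensive.
Import Order.TTheory GRing.Theory Num.Theory.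

Section Graphs.
Variable T : finType.
Implicit Types (E : {set {set T}}) (x y : T).

(* A finite simple graph on the vertex set T is given by its set of edges,
   each edge being the two-element set of its endpoints. *)
Definition simple_graph E := forall e, e \in E -> #|e| = 2.

Definition adj E : rel T := fun x y => (x != y) && ([set x; y] \in E).

Definition is_path E x y (p : seq T) :=
  [&& path (adj E) x p, last x p == y & uniq (x :: p)].

(* Every path has fewer than #|T| edges, so the search below finds the length
   of a shortest path as soon as x and y are connected; otherwise it returns
   the junk value #|T|, which diam never uses. *)
Definition dist E x y : nat :=
  find (fun k => [exists p : k.-tuple T, is_path E x y p]) (iota 0 #|T|).

(* The graph with edge set E and vertex set cover E is connected. *)
Definition edge_connected E :=
  [forall x in cover E, forall y in cover E, connect (adj E) x y].

(* The diameter of an edge set; None stands for infinity. The empty edge set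
   has no vertices, and its diameter is 0. *)
Definition diam E : option nat :=
  if edge_connected E
  then Some (\max_(x in cover E) \max_(y in cover E) dist E x y)
  else None.

Definition diam_le E (d : nat) : bool :=
  if diam E is Some k then k <= d else false.

Lemma distP E x y : connect (adj E) x y ->
  (exists2 p, is_path E x y p & size p = dist E x y) /\
  (forall p, is_path E x y p -> dist E x y <= size p).
Proof.
move=> /connectP[p0 p0P ->{y}].
case: (shortenP p0P) => p pP pU _ {p0 p0P}; set y := last x p.
set a := fun k => [exists p : k.-tuple T, is_path E x y p].
have aP q : is_path E x y q -> a (size q).
  by move=> qP; apply/existsP; exists (in_tuple q).
have ltp q : is_path E x y q -> size q < #|T|.
  by case/and3P=> _ _ /card_uniqP/= H; rewrite -[X in X <= _]H max_card.
have pp : is_path E x y p by apply/and3P; split.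
have ha : has a (iota 0 #|T|).
  by apply/hasP; exists (size p); [rewrite mem_iota ltp | apply: aP].
have dT : dist E x y < #|T| by move: ha; rewrite has_find size_iota.
split.
  have := nth_find 0 ha; rewrite nth_iota // add0n => /existsP[q qP].
  by exists q => //; rewrite size_tuple.
move=> q qP; rewrite leqNgt; apply/negP => lt.
have := @before_find _ 0 a _ _ lt; rewrite nth_iota ?ltp // add0n.
by rewrite aP.
Qed.

End Graphs.

Local Open Scope ring_scope.

(* Parts may be empty, so that having such a partition is monotone in l. *)
Definition diam_partition (R : realType) (n : nat) (eps : R) (d l : nat)
    (E : {set {set 'I_n}}) (F : 'I_l.+1 -> {set {set 'I_n}}) :=
  [/\ E = \bigcup_i F i,
      forall i j, i != j -> [disjoint F i & F j],
      #|F ord0|%:R <= eps * n%:R ^+ 2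
    & forall i, i != ord0 -> diam_le (F i) d].

Definition diam_partitionable (R : realType) (n : nat) (eps : R) (d l : nat) :=
  forall E : {set {set 'I_n}}, simple_graph E ->
  exists F : 'I_l.+1 -> {set {set 'I_n}}, diam_partition eps d E F.

(* The smallest l; the value 0 in the other branch is never reached when
   0 <= eps and 0 < d, see PdiamP. *)
Definition Pdiam (R : realType) (n : nat) (eps : R) (d : nat) : nat :=
  if pselect (exists l, `[< diam_partitionable n eps d l >]) is left ex
  then ex_minn ex else 0%N.

Lemma diam_le_small (T : finType) (E : {set {set T}}) d :
  simple_graph E -> (#|E| <= 1)%N -> (0 < d)%N -> diam_le E d.
Proof.
move=> sE E1 d0.
have adjE x y : x \in cover E -> y \in cover E -> x != y -> adj E x y.
  move=> /bigcupP[e eE xe] /bigcupP[f fE yf] xy.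
  have fe : f = e by apply: (card_le1_eqP E1).
  rewrite /adj xy /=; suff -> : [set x; y] = e by [].
  apply/eqP; rewrite eqEcard (sE _ eE) cards2 xy andbT.
  by apply/subsetP => z; rewrite !inE => /orP[] /eqP-> //; rewrite -fe.
have con x y : x \in cover E -> y \in cover E -> connect (adj E) x y.
  move=> xE yE; have [->|xy] := eqVneq x y; first exact: connect0.
  exact/connect1/adjE.
rewrite /diam_le /diam ifT; last first.
  by apply/forallP => x; apply/implyP => xE; apply/forallP => y;
     apply/implyP => yE; apply: con.
apply/bigmax_leqP => x xE; apply/bigmax_leqP => y yE.
apply: leq_trans d0; have [_ H] := distP (con x y xE yE).
have [xy|xy] := eqVneq x y.
  by apply: leq_trans (H [::] _) _ => //; rewrite /is_path /= xy eqxx.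
by apply: (H [:: y]); rewrite /is_path /= adjE // eqxx inE xy.
Qed.

Lemma diam_partitionable_ex (R : realType) n (eps : R) d :
  0 <= eps -> (0 < d)%N -> exists l, diam_partitionable n eps d l.
Proof.
move=> e0 d0; exists #|{set 'I_n}| => E sE.
pose F (i : 'I_(#|{set 'I_n}|).+1) : {set {set 'I_n}} :=
  [set e in E | i == lift ord0 (enum_rank e)].
exists F; split.
- apply/setP => e; apply/idP/bigcupP => [eE|[i _]]; last by rewrite inE => /andP[].
  by exists (lift ord0 (enum_rank e)); rewrite // inE eE eqxx.
- move=> i j ij; apply/pred0P => e /=; rewrite !inE.
  apply/negP => /andP[/andP[_ /eqP ei] /andP[_ /eqP ej]].
  by rewrite ei ej eqxx in ij.
- suff -> : F ord0 = set0 by rewrite cards0 mulr_ge0 // exprn_ge0.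
  by apply/setP => e; rewrite !inE andbC; case: eqP.
- move=> i _; apply: diam_le_small => //.
    by move=> e; rewrite inE => /andP[/sE].
  apply/card_le1_eqP => e f; rewrite !inE => /andP[_ /eqP->] /andP[_ /eqP].
  by move=> /lift_inj/enum_rank_inj.
Qed.

Lemma PdiamP (R : realType) n (eps : R) d : 0 <= eps -> (0 < d)%N ->
  diam_partitionable n eps d (Pdiam n eps d) /\
  (forall l, diam_partitionable n eps d l -> (Pdiam n eps d <= l)%N).
Proof.
move=> e0 d0; rewrite /Pdiam; case: pselect => [ex|[]]; last first.
  by have [l lP] := diam_partitionable_ex n e0 d0; exists l; apply/asboolP.
case: ex_minnP => m /asboolP mP mmin; split=> // l lP.
by apply: mmin; apply/asboolP.
Qed.

(* Main.v *)
Require Import Defs.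
From mathcomp Require Import all_boot all_order all_algebra.
From mathcomp Require Import boolp reals.
From mathcomp Require Import finfield zify ring lra.
Set Implicit Arguments.
Unset Strict Implicit.
Unset Printing Implicit Defensive.
Import Order.TTheory GRing.Theory Num.Theory.
Local Open Scope ring_scope.

(* Upper bounds. For d = 2 the stars at the vertices partition the graph. For
   d = 3, 4 one removes greedily a large part of small diameter from a graph
   with e edges: by counting homomorphisms of the 4-cycle, some edge xy has at
   least 4 e^3 / n^4 edges between N(x) and N(y), and these have diameter at
   most 3; by counting paths of length 2, some vertex v has at least
   2 e^2 / n^2 edges touching N(v), and these have diameter at most 4. Hence
   after l steps at most n^2 / sqrt(8 l), respectively n^2 / (2 l), edges are
   left.

   Lower bounds. All use bipartite graphs in which every part of diameter at
   most d is small. For d = 4 take disjoint copies of K_{s,s} with s about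
   8 eps n. For d = 2 the parts are complete bipartite, and a random subgraph of
   K_{m,m} of density close to 1 contains no complete bipartite subgraph with
   more than C m edges. For d = 3 take a random subgraph S of the incidence
   graph y + b = a x of points (x, y) and lines (a, b) over a field with q
   elements, q of order 1 / eps, and replace every vertex by t independent
   copies. A part of diameter at most 3 projects onto a configuration in S in
   which any two points lie on a line and any two lines meet, i.e. a possibly
   degenerate projective plane. Degenerate ones have at most 4 q incidences,
   those of order below q^(1/3) have O(q) incidences, and the larger ones are
   destroyed by the random choice: a plane is determined by its set of A points
   and has |A| (order + 1) incidences, more than the 2 log q |A| bits that are
   needed to describe A. *)

(** * Walks and partitions *)

Lemma leq_card_bigcup (I T : finType) (P : pred I) (F : I -> {set T}) :
  (#|\bigcup_(i | P i) F i| <= \sum_(i | P i) #|F i|)%N.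
Proof.
elim/big_rec2: _ => [|i m A _ Am]; first by rewrite cards0.
by apply: leq_trans (leq_card_setU _ _).1 _; rewrite leq_add2l.
Qed.

Section Walks.
Variable T : finType.
Implicit Types (E F : {set {set T}}) (x y : T).

(** Together with its converse below, this trades distances for walks, which may repeat vertices and
    are easier to build and to analyse. *)
Lemma diam_le_walk E d x y : diam_le E d -> x \in cover E -> y \in cover E ->
  exists p, [/\ path (adj E) x p, last x p = y & (size p <= d)%N].
Proof.
rewrite /diam_le /diam; case: ifP => // con dE xE yE.
have /(_ x)/implyP/(_ xE)/forallP/(_ y)/implyP/(_ yE) cxy := forallP con.
have [[p /and3P[pP /eqP pl _] ps] _] := distP cxy.
exists p; split=> //; rewrite ps.
have /bigmax_leqP/(_ x xE) := dE; apply: leq_trans.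
exact: (leq_bigmax_cond (F := fun y => dist E x y)).
Qed.

(** A walk shortens to a path on a subset of its vertices, hence one that is no longer. *)
Lemma walk_diam_le E d :
  (forall x y, x \in cover E -> y \in cover E ->
    exists p, [/\ path (adj E) x p, last x p = y & (size p <= d)%N]) ->
  diam_le E d.
Proof.
move=> H.
have con x y : x \in cover E -> y \in cover E -> connect (adj E) x y.
  by move=> xE yE; have [p [pP <- _]] := H x y xE yE; apply/connectP; exists p.
rewrite /diam_le /diam ifT; last first.
  by apply/forallP => x; apply/implyP => xE; apply/forallP => y;
     apply/implyP => yE; apply: con.
apply/bigmax_leqP => x xE; apply/bigmax_leqP => y yE.
have [p [pP pl ps]] := H x y xE yE.
have [_ min] := distP (con x y xE yE).
move: pl; case/shortenP: pP => p' p'P p'U sub pl.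
apply: leq_trans (min p' _) (leq_trans (uniq_leq_size _ sub) ps).
  by rewrite /is_path p'P pl eqxx.
by case/andP: p'U.
Qed.

Lemma adj_sym E : symmetric (adj E).
Proof. by move=> x y; rewrite /adj eq_sym setUC. Qed.

Lemma simple_graphS E F : F \subset E -> simple_graph E -> simple_graph F.
Proof. by move=> /subsetP FE sE e /FE/sE. Qed.

Lemma coverP E x : simple_graph E ->
  reflect (exists y, adj E x y) (x \in cover E).
Proof.
move=> sE; apply: (iffP idP) => [/bigcupP[e eE xe]|[y /andP[_ xyE]]].
  have /eqP/cards2P[a [b [ab eab]]] := sE e eE.
  move: xe eE; rewrite {}eab !inE => /orP[] /eqP-> abE.
    by exists b; rewrite /adj ab.
  by exists a; rewrite /adj eq_sym ab setUC.
by apply/bigcupP; exists [set x; y] => //; rewrite !inE eqxx.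
Qed.
End Walks.

(** [Q k m] is an invariant relating the number [k] of removals so far to the number [m] of
    remaining edges. The offset [l0] counts earlier removals, so that the induction on [l] can peel
    off the first part. *)
Lemma greedy n d (Q : nat -> nat -> Prop) :
  (forall E : {set {set 'I_n}}, simple_graph E ->
     exists F : {set {set 'I_n}}, [/\ F \subset E, diam_le F d &
                   forall l, Q l #|E| -> Q l.+1 #|E :\: F|]) ->
  forall l l0 (E : {set {set 'I_n}}), simple_graph E -> Q l0 #|E| ->
  exists F : nat -> {set {set 'I_n}},
    [/\ E = \bigcup_(i < l.+1) F i,
        forall i j, (i < j < l.+1)%N -> [disjoint F i & F j],
        forall i, (0 < i < l.+1)%N -> diam_le (F i) d
      & Q (l0 + l)%N #|F 0%N|].
Proof.
move=> step; elim=> [|l IHl] l0 E sE Q0.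
  exists (fun=> E); split; rewrite ?addn0 //; first by rewrite big_ord1.
  - by move=> i [|j]; rewrite ltnS ?ltn0 // ?andbF.
  - by case=> [|i]; rewrite ?ltnn.
have [X [XE dX QX]] := step E sE.
have sEX : simple_graph (E :\: X) by apply: simple_graphS sE; apply: subsetDl.
have [F [EF dF diF QF]] := IHl l0.+1 _ sEX (QX _ Q0).
(* The part removed first gets the last index, so that index 0 always holds the leftover edges. *)
pose F' i := if i == l.+1 then X else F i.
have F'lt i : (i < l.+1)%N -> F' i = F i by rewrite /F'; case: ltngtP.
exists F'; split.
- rewrite big_ord_recr /= {2}/F' eqxx.
  rewrite (eq_bigr (fun i : 'I_l.+1 => F i)) => [|i _]; last by rewrite F'lt /=.
  rewrite -EF; apply/setP => e; rewrite !inE.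
  by case: (boolP (e \in X)) => [/(subsetP XE)->|]; rewrite ?orbF.
- move=> i j /andP[ij]; rewrite ltnS leq_eqVlt => /orP[/eqP j_eq|jl].
    rewrite j_eq in ij *; rewrite F'lt // /F' eqxx.
    have : F i \subset E :\: X.
      by rewrite EF; apply: (bigcup_sup (Ordinal ij)).
    by rewrite subsetD => /andP[].
  by rewrite !F'lt ?dF ?ij // (ltn_trans ij).
- move=> i /andP[i0]; rewrite ltnS leq_eqVlt => /orP[/eqP->|il].
    by rewrite /F' eqxx.
  by rewrite F'lt // diF ?i0.
- by rewrite F'lt // -addSnnS.
Qed.

Lemma Pdiam_le (R : realType) n (eps : R) d l : 0 <= eps -> (0 < d)%N ->
  (forall E : {set {set 'I_n}}, simple_graph E ->
   exists F : nat -> {set {set 'I_n}},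
    [/\ E = \bigcup_(i < l.+1) F i,
        forall i j, (i < j < l.+1)%N -> [disjoint F i & F j],
        forall i, (0 < i < l.+1)%N -> diam_le (F i) d
      & #|F 0%N|%:R <= eps * n%:R ^+ 2]) ->
  (Pdiam n eps d <= l)%N.
Proof.
move=> e0 d0 H; apply: (PdiamP n e0 d0).2 => E sE.
have [F [EF dF diF F0]] := H E sE.
exists (fun i => F i); split=> // i.
- move=> j; rewrite neq_ltn => /orP[ij|ij]; first by rewrite dF // ij /=.
  by rewrite disjoint_sym dF // ij /=.
- by move=> i0; apply: diF; rewrite ltn_ord lt0n andbT.
Qed.

(** Source of all lower bounds: in an optimal partition, the edges outside the exceptional part are
    shared among [Pdiam n eps d] parts of at most [M] edges each. *)
Lemma le_Pdiam (R : realType) n (eps : R) d (E : {set {set 'I_n}}) M :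
  0 <= eps -> (0 < d)%N -> simple_graph E ->
  (forall F : {set {set 'I_n}}, F \subset E -> diam_le F d -> (#|F| <= M)%N) ->
  #|E|%:R <= eps * n%:R ^+ 2 + (Pdiam n eps d)%:R * M%:R.
Proof.
move=> e0 d0 sE maxF.
have [F [EF dF F0 diF]] := (PdiamP n e0 d0).1 E sE.
apply: le_trans (lerD F0 (lexx _)).
rewrite -natrM -natrD ler_nat {1}EF.
apply: leq_trans (leq_card_bigcup _ _) _; rewrite big_ord_recl leq_add2l.
rewrite -[X in (_ <= X * _)%N]card_ord -sum_nat_const.
apply: leq_sum => i _; apply: maxF; last exact: diF.
by rewrite EF; apply: bigcup_sup.
Qed.

(** * Counting edges of parts of small diameter *)

Section NatSums.
Local Open Scope nat_scope.

(** Cauchy-Schwarz, obtained by summing $2ab \le a^2 + b^2$ over all pairs of values of [f]. *)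
Lemma sum_sqr_le (I : finType) (f : I -> nat) :
  (\sum_i f i) ^ 2 <= #|I| * \sum_i f i ^ 2.
Proof.
rewrite -(leq_pmul2l (isT : 0 < 2)) -mulnn big_distrlr big_distrr /=.
under eq_bigr do rewrite big_distrr /=.
apply: (@leq_trans (\sum_i \sum_j (f i ^ 2 + f j ^ 2))).
  by apply: leq_sum => i _; apply: leq_sum => j _; apply: nat_Cauchy.
under eq_bigr do rewrite big_split /= sum_nat_const.
by rewrite big_split /= -big_distrr /= sum_nat_const addnn mul2n.
Qed.

Lemma exists_ge_average (I : finType) (P : pred I) (f : I -> nat) i0 :
  P i0 -> exists2 i, P i & \sum_(j | P j) f j <= #|P| * f i.
Proof.
move=> Pi0; case: (arg_maxnP f Pi0) => i Pi maxi; exists i => //.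
by rewrite -sum_nat_const; apply: leq_sum.
Qed.
End NatSums.

Section Degrees.
Local Open Scope nat_scope.
Variable T : finType.
Implicit Types (E F : {set {set T}}) (x y : T).

Lemma card_adj E : simple_graph E ->
  #|[set u : T * T | adj E u.1 u.2]| = 2 * #|E|.
Proof.
move=> sE; rewrite -sum1_card.
rewrite (partition_big (fun u : T * T => [set u.1; u.2]) (mem E)) /=; last first.
  by move=> u; rewrite inE => /andP[].
rewrite mulnC -sum_nat_const; apply: eq_bigr => e eE.
have /eqP/cards2P[a [b [ab eab]]] := sE e eE.
have abU : (a, b) != (b, a) by rewrite xpair_eqE negb_and ab.
have <- : #|[set (a, b); (b, a)]| = 2 by rewrite cards2 abU.
rewrite sum1_card; apply/eq_card => -[x y].
rewrite !inE /adj /= !xpair_eqE unfold_in /= inE /adj /=.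
apply/andP/orP => [[/andP[xy _] /eqP exy]|].
  have: x \in e by rewrite -exy !inE eqxx.
  have: y \in e by rewrite -exy !inE eqxx orbT.
  rewrite eab !inE => /orP[] /eqP yE /orP[] /eqP xE;
  by move: xy; rewrite xE yE !eqxx ?andbT; auto.
have ba : b != a by rewrite eq_sym.
case=> /andP[/eqP-> /eqP->]; first by rewrite ab -eab eE.
by rewrite ba setUC -eab eE.
Qed.

Definition deg E x := \sum_y (adj E x y : nat).

Lemma sum_deg E : simple_graph E -> \sum_x deg E x = 2 * #|E|.
Proof.
move=> sE; rewrite -card_adj // /deg pair_big /= -sum1_card [RHS]big_mkcond /=.
by apply: eq_bigr => u _; rewrite inE; case: adj.
Qed.

Lemma sum_deg_sqr E : simple_graph E ->
  4 * #|E| ^ 2 <= #|T| * \sum_x deg E x ^ 2.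
Proof.
by move=> sE; rewrite -[4]/(2 ^ 2) -expnMn -sum_deg //; apply: sum_sqr_le.
Qed.

Definition touching E v := [set e in E | [exists u in e, adj E v u]].

Lemma adj_touching E v x y :
  adj (touching E v) x y = adj E x y && (adj E v x || adj E v y).
Proof.
rewrite /adj inE -!andbA; congr [&& _, _ & _].
apply/existsP/orP => [[u]|[] H].
- by rewrite !inE => /andP[/orP[] /eqP-> ?]; [left|right].
- by exists x; rewrite !inE eqxx.
- by exists y; rewrite !inE eqxx orbT.
Qed.

Lemma touching_sub E v : touching E v \subset E.
Proof. by apply/subsetP => e; rewrite inE => /andP[]. Qed.

(** The part contains all edges at [v], so each of its vertices reaches [v] inside the part in at
    most two steps. *)
Lemma diam_touching E v : simple_graph E -> diam_le (touching E v) 4.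
Proof.
move=> sE; set F := touching E v.
have sF : simple_graph F := simple_graphS (touching_sub E v) sE.
have to_v x : x \in cover F ->
    adj F x v \/ exists2 w, adj F x w & adj F w v.
  case/(coverP _ sF) => y; rewrite adj_touching => /andP[xy /orP[vx|vy]].
    by left; rewrite adj_touching adj_sym vx.
  right; exists y; rewrite adj_touching ?xy ?vy ?orbT //.
  by rewrite adj_sym vy.
apply: walk_diam_le => x y xF yF.
have [[xv|[w xw wv]] [yv|[z yz zv]]] := (to_v x xF, to_v y yF).
- by exists [:: v; y]; split=> //=; rewrite xv adj_sym yv.
- by exists [:: v; z; y]; split=> //=; rewrite xv (adj_sym F v) zv adj_sym yz.
- by exists [:: w; v; y]; split=> //=; rewrite xw wv adj_sym yv.
- exists [:: w; v; z; y]; split=> //=.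
  by rewrite xw wv (adj_sym F v) zv adj_sym yz.
Qed.

Lemma card_touching E v : simple_graph E ->
  \sum_u adj E v u * deg E u <= 2 * #|touching E v|.
Proof.
move=> sE; have sF := simple_graphS (touching_sub E v) sE.
rewrite -sum_deg //; apply: leq_sum => u _; rewrite big_distrr /=.
apply: leq_sum => w _; rewrite adj_touching.
by case: (adj E v u); case: (adj E u w).
Qed.

(** Averaging over [v]: the sums of the degrees of the neighbours of [v] add up to the sum of all
    squared degrees, which Cauchy-Schwarz bounds below by $4e^2/|T|$, where $e$ is the number of
    edges. *)
Lemma exists_touching E : simple_graph E -> E != set0 ->
  exists v, 2 * #|E| ^ 2 <= #|T| ^ 2 * #|touching E v|.
Proof.
move=> sE /set0Pn[e eE].
have /card_gt0P[v0 _] : 0 < #|e| by rewrite sE.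
have [v _ maxv] := exists_ge_average (fun v => \sum_u adj E v u * deg E u)
  (isT : predT v0).
exists v; rewrite -(leq_pmul2l (isT : 0 < 2)).
have double : \sum_u deg E u ^ 2 = \sum_v \sum_u adj E v u * deg E u.
  rewrite exchange_big /=; apply: eq_bigr => u _.
  rewrite -big_distrl /= -mulnn; congr (_ * _).
  by apply: eq_bigr => w _; rewrite adj_sym.
have := sum_deg_sqr sE; rewrite double => /leq_trans.
have /leq_trans := maxv => /(_ (#|T| * (2 * #|touching E v|))).
rewrite !leq_mul2l card_touching // orbT => /(_ isT) H.
move=> /(_ (#|T| * (#|T| * (2 * #|touching E v|)))).
rewrite leq_mul2l H orbT => /(_ isT).
by nia.
Qed.

(** The number of common neighbours; for [b = x] it is the degree of [x]. *)
Definition codeg E x b := \sum_y adj E x y * adj E y b.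

Lemma sum_codeg E : \sum_x \sum_b codeg E x b = \sum_y deg E y ^ 2.
Proof.
under eq_bigr do rewrite exchange_big /=.
rewrite exchange_big /=; apply: eq_bigr => y _.
under eq_bigr do rewrite -big_distrr /=.
rewrite -big_distrl /= -mulnn; congr (_ * _).
by apply: eq_bigr => x _; rewrite adj_sym.
Qed.

(** Cauchy-Schwarz is applied twice: to the degrees over the vertices, then to the codegrees over
    the ordered pairs of vertices. *)
Lemma sum_codeg_sqr E : simple_graph E ->
  16 * #|E| ^ 4 <= #|T| ^ 4 * \sum_x \sum_b codeg E x b ^ 2.
Proof.
move=> sE; have := sum_sqr_le (fun u : T * T => codeg E u.1 u.2).
rewrite -(pair_big predT predT (fun x b => codeg E x b)) /=.
rewrite -(pair_big predT predT (fun x b => codeg E x b ^ 2)) /=.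
rewrite sum_codeg card_prod => H2; have H1 := sum_deg_sqr sE.
have H : (4 * #|E| ^ 2) ^ 2 <= (#|T| * \sum_x deg E x ^ 2) ^ 2.
  by rewrite leq_exp2r.
have -> : 16 * #|E| ^ 4 = (4 * #|E| ^ 2) ^ 2 by lia.
apply: leq_trans H _; rewrite expnMn (expnD _ 2 2) -mulnA leq_mul2l.
by rewrite mulnn in H2; rewrite H2 orbT.
Qed.

Definition crossing E x y :=
  [set e in E | [exists a, [exists b,
    [&& adj E x a, adj E y b & e == [set a; b]]]]].

Lemma crossing_sub E x y : crossing E x y \subset E.
Proof. by apply/subsetP => e; rewrite inE => /andP[]. Qed.

Lemma crossing_adj E x y a b :
  adj E x a -> adj E y b -> adj E a b -> adj (crossing E x y) a b.
Proof.
move=> xa yb /andP[ab abE]; rewrite /adj ab inE abE /=.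
by apply/existsP; exists a; apply/existsP; exists b; rewrite xa yb eqxx.
Qed.

Lemma cover_crossing E x y u :
  u \in cover (crossing E x y) -> adj E x u \/ adj E y u.
Proof.
case/bigcupP => e; rewrite inE => /andP[_ /existsP[a /existsP[b]]].
by case/and3P => xa yb /eqP->; rewrite !inE => /orP[] /eqP->; [left|right].
Qed.

(** Since [x] and [y] are neighbours, all edges at [x] and all edges at [y] belong to the part,
    including the edge between them; any two vertices are then joined through [x], [y] or both. *)
Lemma diam_crossing E x y : adj E x y -> diam_le (crossing E x y) 3.
Proof.
move=> xy; have yx : adj E y x by rewrite adj_sym.
set F := crossing E x y.
have Fxy : adj F x y by rewrite adj_sym crossing_adj.
have Fyx : adj F y x by rewrite adj_sym.
have Fx u : adj E x u -> adj F u x.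
  by move=> xu; apply: crossing_adj => //; rewrite adj_sym.
have Fy u : adj E y u -> adj F y u by move=> yu; apply: crossing_adj.
apply: walk_diam_le => u w /cover_crossing uF /cover_crossing wF.
have [[xu|yu] [xw|yw]] := (uF, wF).
- by exists [:: x; w]; rewrite /= Fx // adj_sym Fx.
- by exists [:: x; y; w]; rewrite /= Fx // Fxy Fy.
- by exists [:: y; x; w]; rewrite /= adj_sym Fy // Fyx adj_sym Fx.
- by exists [:: y; w]; rewrite /= adj_sym Fy // Fy.
Qed.

Definition cross_count E x y :=
  \sum_a \sum_b adj E x a * adj E y b * adj E a b.

Lemma card_crossing E x y : simple_graph E ->
  cross_count E x y <= 2 * #|crossing E x y|.
Proof.
move=> sE; have sF := simple_graphS (crossing_sub E x y) sE.
rewrite -sum_deg //; apply: leq_sum => a _; apply: leq_sum => b _.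
case: (boolP (adj E x a)) => xa //; case: (boolP (adj E y b)) => yb //.
case: (boolP (adj E a b)) => ab //.
by rewrite crossing_adj.
Qed.

(* Both sides count the homomorphisms of a 4-cycle into the graph. *)
Lemma sum_cross_count E :
  \sum_x \sum_y adj E x y * cross_count E x y =
  \sum_x \sum_b codeg E x b ^ 2.
Proof.
apply: eq_bigr => x _.
under eq_bigr do rewrite /cross_count exchange_big big_distrr /=.
rewrite exchange_big /=; apply: eq_bigr => b _.
rewrite -mulnn {1}/codeg big_distrl /=; apply: eq_bigr => y _.
rewrite /codeg !big_distrr /=; apply: eq_bigr => a _.
by rewrite -!mulnA mulnCA (mulnCA (adj E y b)) mulnCA.
Qed.

(** Average of [cross_count] over the $2e$ oriented edges, $e$ being the number of edges: the total
    is the number of homomorphisms of the 4-cycle, at least $16e^4/|T|^4$. *)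
Lemma exists_crossing E : simple_graph E -> E != set0 ->
  exists x y, adj E x y /\ 4 * #|E| ^ 3 <= #|T| ^ 4 * #|crossing E x y|.
Proof.
move=> sE E0; have e_gt0 : 0 < #|E| by rewrite card_gt0.
have : 0 < #|[set u : T * T | adj E u.1 u.2]| by rewrite card_adj // muln_gt0.
case/card_gt0P => u0; rewrite inE => u0P.
have [[x y] /= xy maxxy] := exists_ge_average (fun u => cross_count E u.1 u.2)
  (u0P : [pred u | adj E u.1 u.2] u0).
exists x, y; split=> //.
have cardP : #|[pred u : T * T | adj E u.1 u.2]| = 2 * #|E|.
  by rewrite -card_adj //; apply: eq_card => u; rewrite !inE.
have sumP : \sum_(u : T * T | adj E u.1 u.2) cross_count E u.1 u.2 =
    \sum_x \sum_b codeg E x b ^ 2.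
  rewrite -sum_cross_count big_mkcond /=.
  rewrite (pair_big predT predT (fun x y => adj E x y * cross_count E x y)) /=.
  by apply: eq_bigr => u _; case: (adj E u.1 u.2); rewrite ?mul1n ?mul0n.
rewrite sumP cardP in maxxy.
have H1 := sum_codeg_sqr sE; have H2 := card_crossing x y sE.
rewrite -(leq_pmul2l (_ : 0 < 4 * #|E|)) ?muln_gt0 //.
have -> : 4 * #|E| * (4 * #|E| ^ 3) = 16 * #|E| ^ 4 by rewrite mulnACA -expnS.
apply: leq_trans H1 _; rewrite mulnCA leq_mul2l; apply/orP; right.
by apply: leq_trans maxxy (leq_trans (leq_mul (leqnn _) H2) _); rewrite mulnACA mulnA.
Qed.
End Degrees.

(** * Upper bounds *)

Section UpperBounds.
Variable R : realType.
Implicit Types (N eps : R).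

(** One greedy step for diameter 3, with $N = n^4$ and [e], [e'] the edge counts before and after.
    For $y = 4e^2 \le N$ it comes down to $(N + 2y)(N - y)^2 \le N^3$, the difference being $y^2(3N
    - 2y)$. *)
Lemma potential_step3 N (e e' l : R) : 0 <= N -> 0 <= e' -> e' <= e ->
  4 * e ^+ 3 <= N * (e - e') -> 8 * l * e ^+ 2 <= N ->
  8 * (l + 1) * e' ^+ 2 <= N.
Proof.
move=> N0 e'0 e'e He Hl.
have [e0|e_le0] := ltP 0 e; last first.
  have -> : e' = 0 by lra.
  by rewrite expr0n /= mulr0.
set u := e * (N - 4 * e ^+ 2).
have uE : N * e' <= u by rewrite /u; nra.
have u0 : 0 <= u by apply: le_trans uE; apply: mulr_ge0.
have y0 : 0 <= N - 4 * e ^+ 2 by rewrite -(pmulr_rge0 _ e0).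
have {}N0 : 0 < N by have := exprn_gt0 2 e0; lra.
have [l1|l1] := ltP (l + 1) 0.
  apply: le_trans (ltW N0); rewrite mulr_le0_ge0 ?sqr_ge0 //; lra.
rewrite -(ler_pM2l (exprn_gt0 2 N0)).
have -> : N ^+ 2 * (8 * (l + 1) * e' ^+ 2) = 8 * (l + 1) * (N * e') ^+ 2 by ring.
apply: (@le_trans _ _ (8 * (l + 1) * u ^+ 2)).
  apply: ler_wpM2l; first lra.
  by rewrite ler_sqr ?nnegrE ?mulr_ge0 // ltW.
have -> : 8 * (l + 1) * u ^+ 2 =
    (8 * l * e ^+ 2 + 8 * e ^+ 2) * (N - 4 * e ^+ 2) ^+ 2 by rewrite /u; ring.
apply: (@le_trans _ _ ((N + 8 * e ^+ 2) * (N - 4 * e ^+ 2) ^+ 2)).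
  by apply: ler_wpM2r; rewrite ?sqr_ge0 // lerD2r.
set y := 4 * e ^+ 2 in y0 *.
have -> : 8 * e ^+ 2 = 2 * y by rewrite /y; ring.
have y_ge0 : 0 <= y by rewrite mulr_ge0 ?sqr_ge0.
rewrite -subr_ge0.
have -> : N ^+ 2 * N - (N + 2 * y) * (N - y) ^+ 2 = y ^+ 2 * (3 * N - 2 * y) by ring.
by rewrite mulr_ge0 ?sqr_ge0 //; lra.
Qed.

(** The analogue for diameter 4, with $N = n^2$; it comes down to $(N + 2e)(N - 2e) \le N^2$. *)
Lemma potential_step4 N (e e' l : R) : 0 <= N -> 0 <= e' -> e' <= e ->
  2 * e ^+ 2 <= N * (e - e') -> 2 * l * e <= N ->
  2 * (l + 1) * e' <= N.
Proof.
move=> N0 e'0 e'e He Hl.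
have [e0|e_le0] := ltP 0 e; last first.
  have -> : e' = 0 by lra.
  by rewrite mulr0.
have uE : N * e' <= e * (N - 2 * e) by nra.
have y0 : 0 <= N - 2 * e.
  by rewrite -(pmulr_rge0 _ e0); apply: le_trans uE; apply: mulr_ge0.
have {}N0 : 0 < N by lra.
have [l1|l1] := ltP (l + 1) 0.
  by apply: le_trans (ltW N0); rewrite mulr_le0_ge0 //; lra.
rewrite -(ler_pM2l N0).
have -> : N * (2 * (l + 1) * e') = 2 * (l + 1) * (N * e') by ring.
apply: (@le_trans _ _ (2 * (l + 1) * (e * (N - 2 * e)))).
  by apply: ler_wpM2l; first lra.
have -> : 2 * (l + 1) * (e * (N - 2 * e)) = (2 * l * e + 2 * e) * (N - 2 * e) by ring.
apply: (@le_trans _ _ ((N + 2 * e) * (N - 2 * e))).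
  by apply: ler_wpM2r; rewrite ?lerD2r.
by nra.
Qed.

Lemma card_setD_sub (T : finType) (A B : {set T}) : B \subset A ->
  [/\ (#|A :\: B|%:R : R) <= #|A|%:R & #|B|%:R = #|A|%:R - #|A :\: B|%:R :> R].
Proof.
move=> BA; rewrite ler_nat subset_leq_card ?subsetDl //; split=> //.
by rewrite -(cardsID B A) (setIidPr BA) natrD addrK.
Qed.

Lemma Pdiam3_le n (eps : R) l : 0 <= eps -> (0 < l)%N ->
  1 <= 8 * l%:R * eps ^+ 2 -> (Pdiam n eps 3 <= l)%N.
Proof.
move=> e0 l0 leps; apply: Pdiam_le => // E sE.
pose Q (k m : nat) : Prop := 8 * k%:R * m%:R ^+ 2 <= n%:R ^+ 4 :> R.
have step (D : {set {set 'I_n}}) : simple_graph D ->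
     exists F : {set {set 'I_n}}, [/\ F \subset D, diam_le F 3 &
                   forall k, Q k #|D| -> Q k.+1 #|D :\: F|].
  move=> sD; have [D0|D0] := eqVneq D set0.
    exists set0; rewrite sub0set D0 setD0; split=> //.
      by apply: diam_le_small => [e||]; rewrite ?inE ?cards0.
    by move=> k _; rewrite /Q cards0 expr0n /= mulr0 exprn_ge0.
  have [x [y [xy card]]] := exists_crossing sD D0.
  exists (crossing D x y); rewrite crossing_sub diam_crossing //; split=> // k.
  have [DF card_eq] := card_setD_sub (crossing_sub D x y).
  rewrite /Q -(natr1 k) => Qk; apply: (potential_step3 _ _ DF) => //; rewrite ?exprn_ge0 //.
  by rewrite -card_eq -!natrX -!natrM ler_nat -[in (n ^ 4)%N](card_ord n).
have Q0 : Q 0%N #|E| by rewrite /Q mulr0 mul0r exprn_ge0.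
have [F [EF dF diF QF]] := greedy step l sE Q0.
exists F; split=> //; rewrite /Q add0n in QF.
rewrite -ler_sqr ?nnegrE ?mulr_ge0 // -(ler_pM2l (_ : 0 < 8 * l%:R)); last first.
  by rewrite mulr_gt0 // ltr0n.
apply: le_trans QF _; rewrite exprMn mulrA -exprM.
by rewrite -[leLHS]mul1r ler_wpM2r ?exprn_ge0.
Qed.

Lemma Pdiam4_le n (eps : R) l : 0 <= eps -> (0 < l)%N ->
  1 <= 2 * l%:R * eps -> (Pdiam n eps 4 <= l)%N.
Proof.
move=> e0 l0 leps; apply: Pdiam_le => // E sE.
pose Q (k m : nat) : Prop := 2 * k%:R * m%:R <= n%:R ^+ 2 :> R.
have step (D : {set {set 'I_n}}) : simple_graph D ->
     exists F : {set {set 'I_n}}, [/\ F \subset D, diam_le F 4 &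
                   forall k, Q k #|D| -> Q k.+1 #|D :\: F|].
  move=> sD; have [D0|D0] := eqVneq D set0.
    exists set0; rewrite sub0set D0 setD0; split=> //.
      by apply: diam_le_small => [e||]; rewrite ?inE ?cards0.
    by move=> k _; rewrite /Q cards0 mulr0 exprn_ge0.
  have [v card] := exists_touching sD D0.
  exists (touching D v); rewrite touching_sub diam_touching //; split=> // k.
  have [DF card_eq] := card_setD_sub (touching_sub D v).
  rewrite /Q -(natr1 k) => Qk; apply: (potential_step4 _ _ DF) => //; rewrite ?exprn_ge0 //.
  by rewrite -card_eq -!natrX -!natrM ler_nat -[in (n ^ 2)%N](card_ord n).
have Q0 : Q 0%N #|E| by rewrite /Q mulr0 mul0r exprn_ge0.
have [F [EF dF diF QF]] := greedy step l sE Q0.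
exists F; split=> //; rewrite /Q add0n in QF.
rewrite -(ler_pM2l (_ : 0 < 2 * l%:R)); last by rewrite mulr_gt0 // ltr0n.
by apply: le_trans QF _; rewrite mulrA -[leLHS]mul1r ler_wpM2r ?exprn_ge0.
Qed.

Lemma Pdiam2_le n (eps : R) : 0 <= eps -> (Pdiam n eps 2 <= n)%N.
Proof.
move=> e0; apply: Pdiam_le => // E sE.
(* Part [k.+1] is the star of the edges whose smaller endpoint is [k]. Subtracting [setT] empties
   part 0, which would otherwise repeat the star at vertex 0 because [0.-1] is 0. *)
pose F k := [set e in E | [exists i in e, ((i : nat) == k.-1) &&
  [forall j in e, (i <= j)%N]]] :\: (if k == 0%N then setT else set0).
exists F; split.
- apply/setP => e; apply/idP/bigcupP => [eE|[k _]]; last first.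
    by rewrite !inE => /andP[_ /andP[]].
  have /eqP/cards2P[a [b [ab eab]]] := sE e eE.
  have [i ie imin] : exists2 i, i \in e & forall j, j \in e -> (i <= j)%N.
    have ae : a \in e by rewrite eab !inE eqxx.
    by case: (arg_minnP (fun j : 'I_n => j : nat) ae) => i ie imin; exists i.
  exists (lift ord0 i) => //; rewrite !inE eE lift0 /=.
  apply/existsP; exists i; rewrite ie eqxx /=.
  by apply/forallP => j; apply/implyP/imin.
- move=> i j /andP[ij _]; apply/pred0P => e /=; apply/negP => /andP[].
  rewrite !inE; case: i ij => [|i] ij; first by rewrite inE.
  case: j ij => // j ij /andP[_ /andP[_ /existsP[x /and3P[xe /eqP xi xmin]]]].
  case/andP=> _ /andP[_ /existsP[y /and3P[ye /eqP yj ymin]]].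
  have := implyP (forallP xmin y) ye; have := implyP (forallP ymin x) xe.
  by rewrite xi yj /=; move=> *; lia.
- case=> // k /andP[_]; rewrite ltnS => kn; set c := Ordinal kn.
  have sF : simple_graph (F k.+1).
    by apply: simple_graphS sE; apply/subsetP => e; rewrite !inE => /and3P[].
  have cF (e : {set 'I_n}) : e \in F k.+1 -> c \in e.
    rewrite !inE => /andP[_ /andP[_ /existsP[i /and3P[ie /eqP ik _]]]].
    by have -> : c = i by apply/val_inj; rewrite /= ik.
  have to_c x : x \in cover (F k.+1) -> x = c \/ adj (F k.+1) x c.
    case/(coverP _ sF) => y xy; have /andP[_ /cF] := xy.
    by rewrite !inE => /orP[] /eqP->; auto.
  apply: walk_diam_le => x y /to_c[->|xc] /to_c[->|yc].
  + by exists [::].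
  + by exists [:: y]; rewrite /= adj_sym yc.
  + by exists [:: c]; rewrite /= xc.
  + by exists [:: c; y]; rewrite /= xc adj_sym yc.
- by rewrite /F eqxx setDT cards0 mulr_ge0 // exprn_ge0.
Qed.
End UpperBounds.

(** * Random subsets *)

Section RandomSubset.
Variables (R : realFieldType) (U : finType) (p : R).
Hypotheses (p0 : 0 < p) (p1 : p < 1).
Implicit Types (S X D : {set U}).

(** The probability that a random set, containing each element independently with probability [p],
    equals [S]. *)
Definition weight S : R := \prod_u (if u \in S then p else 1 - p).

Lemma weight_ge0 S : 0 <= weight S.
Proof. by apply: prodr_ge0 => u _; case: ifP => _; rewrite ?subr_ge0 ltW. Qed.

(** The product of the factors [p + G u] is expanded over all sets [S]; the choice [G u = 0] on [X]
    kills the terms in which [S] misses an element of [X]. *)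
Lemma weight_sup X : \sum_S weight S * (X \subset S)%:R = p ^+ #|X|.
Proof.
pose G u : R := if u \in X then 0 else 1 - p.
transitivity (\prod_u (p + G u)); last first.
  rewrite /G (eq_bigr (fun u => if u \in X then p else 1)); last first.
    by move=> u _; case: ifP => _; ring.
  by rewrite -big_mkcond /= prodr_const.
rewrite bigA_distr; apply: eq_bigr => S _.
have [XS|/subsetPn[u uX uS]] := boolP (X \subset S).
  rewrite mulr1; apply: eq_bigr => u _; rewrite /G.
  by case: ifP => // /negbT/(contra (subsetP XS u))/negbTE->.
by rewrite mulr0 (bigD1 u) //= /G (negbTE uS) uX mul0r.
Qed.

Lemma weight_total : \sum_S weight S = 1.
Proof.
have := weight_sup set0; rewrite cards0 expr0 => <-.
by apply: eq_bigr => S _; rewrite sub0set mulr1.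
Qed.

Lemma weight_notin u : \sum_S weight S * (u \notin S)%:R = 1 - p.
Proof.
transitivity (\sum_S (weight S - weight S * ([set u] \subset S)%:R)).
  apply: eq_bigr => S _; rewrite sub1set.
  by case: (u \in S); rewrite /= ?mulr1 ?mulr0 ?subrr ?subr0.
by rewrite sumrB weight_total weight_sup cards1 expr1.
Qed.

(** First moment method: the expected number of sets [X j] inside [S] is below 1/2, and the expected
    size of [D :\: S] is half of the allowed bound [c]. *)
Lemma exists_avoiding (J : finType) (Q : pred J) (X : J -> {set U}) D :
  \sum_(j | Q j) p ^+ #|X j| < 2^-1 ->
  exists S, (forall j, Q j -> ~~ (X j \subset S)) /\
            #|D :\: S|%:R <= 2 * (1 - p) * #|D|%:R.
Proof.
move=> sumX; set c := 2 * (1 - p) * #|D|%:R.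
case: (pickP (fun S => [forall (j | Q j), ~~ (X j \subset S)] &&
                       (#|D :\: S|%:R <= c))) => [S /andP[/forallP QS DS]|none].
  by exists S; split=> // j; apply/implyP.
pose cnt S : R := \sum_(j | Q j) (X j \subset S)%:R.
have cnt_ge0 S : 0 <= cnt S by apply: sumr_ge0.
have bad S : 1 <= cnt S \/ c < #|D :\: S|%:R.
  have /negbT := none S; rewrite negb_and => /orP[|]; last by rewrite -ltNge; right.
  rewrite negb_forall => /existsP[j]; rewrite negb_imply negbK => /andP[Qj XS].
  by left; rewrite /cnt (bigD1 j) //= XS lerDl sumr_ge0.
have Ecnt : \sum_S weight S * cnt S = \sum_(j | Q j) p ^+ #|X j|.
  under eq_bigr do rewrite mulr_sumr.
  by rewrite exchange_big; apply: eq_bigr => j _; rewrite -weight_sup.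
have ED : \sum_S weight S * #|D :\: S|%:R = (1 - p) * #|D|%:R.
  transitivity (\sum_S \sum_(u in D) weight S * (u \notin S)%:R).
    apply: eq_bigr => S _; rewrite -mulr_sumr -natr_sum; congr (_ * _%:R).
    rewrite -sum1_card [LHS]big_mkcond [RHS]big_mkcond /=.
    by apply: eq_bigr => u _; rewrite !inE andbC; do 2!case: (_ \in _).
  rewrite exchange_big /=; under eq_bigr do rewrite weight_notin.
  by rewrite sumr_const mulr_natr.
(* If [D] is empty then [c = 0], and a failing [S] can only fail by containing some [X j]. *)
have [D0|D_neq0] := eqVneq (#|D|%:R : R) 0.
  have : 1 <= \sum_S weight S * cnt S.
    rewrite -weight_total; apply: ler_sum => S _.
    rewrite ler_peMr ?weight_ge0 //; case: (bad S) => //.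
    rewrite /c D0 mulr0 ltNge; move/eqP: D0; rewrite pnatr_eq0 cards_eq0 => /eqP->.
    by rewrite set0D cards0 lexx.
  by rewrite Ecnt; lra.
have c_gt0 : 0 < c by rewrite !mulr_gt0 ?subr_gt0 // lt0r D_neq0 ler0n.
(* Union bound and Markov inequality at once: for a failing [S] one of the two summands is at least
   [c], while their expectations are below [c / 2] and equal to [c / 2]. *)
have : c <= \sum_S weight S * (c * cnt S + #|D :\: S|%:R).
  rewrite -[c in leLHS]mul1r -[1 in leLHS]weight_total mulr_suml; apply: ler_sum => S _.
  rewrite ler_wpM2l ?weight_ge0 //; case: (bad S) => [cS|/ltW DS].
    by apply: ler_wpDr => //; apply: ler_peMr => //; apply: ltW.
  by apply: ler_wpDl => //; rewrite mulr_ge0 ?cnt_ge0 ?ltW.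
under eq_bigr do rewrite mulrDr mulrCA.
rewrite big_split /= -mulr_sumr Ecnt ED => cE.
suff : c * \sum_(j | Q j) p ^+ #|X j| < c * 2^-1 by rewrite /c in cE *; lra.
by rewrite ltr_pM2l.
Qed.
End RandomSubset.

(** There are $4^m$ pairs of sets, and a pair spanning more than $Cm$ cells survives with
    probability at most $p^{Cm} \le 16^{-m}$; the sum is at most $4^{-m} < 1/2$. *)
Lemma exists_biclique_free (R : realFieldType) (p : R) C m :
  0 < p -> p < 1 -> p ^+ C <= 16^-1 -> (0 < m)%N ->
  exists S : {set 'I_m * 'I_m},
    (forall A B, setX A B \subset S -> (#|A| * #|B| <= C * m)%N) /\
    #|~: S|%:R <= 2 * (1 - p) * m%:R ^+ 2.
Proof.
move=> p0 p1 pC m0.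
pose J := ({set 'I_m} * {set 'I_m})%type.
pose Q (j : J) := (C * m < #|j.1| * #|j.2|)%N.
have [|S [QS cS]] := @exists_avoiding R ('I_m * 'I_m)%type p p0 p1 J Q
  (fun j => setX j.1 j.2) setT.
  apply: (@le_lt_trans _ _ (\sum_(j : J) 16^-1 ^+ m)).
    rewrite big_mkcond /=; apply: ler_sum => j _; case: ifP => Qj.
      apply: (@le_trans _ _ (p ^+ (C * m))).
        by rewrite ler_wiXn2l ?(ltW p0) ?(ltW p1) // cardsX ltnW.
      by rewrite exprM lerXn2r ?nnegrE ?invr_ge0 //; apply/exprn_ge0/ltW.
    by rewrite exprn_ge0 // invr_ge0.
  have cset : #|{set 'I_m}| = (2 ^ m)%N.
    by rewrite -cardsT -powersetT card_powerset cardsT card_ord.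
  rewrite sumr_const card_prod !cset -expnMn -[X in X < _]mulr_natr.
  rewrite natrX -exprMn.
  apply: (@le_lt_trans _ _ 4^-1); last by lra.
  have -> : 16^-1 * (2 * 2)%:R = 4^-1 :> R by lra.
  by rewrite -[leRHS]expr1 ler_wiXn2l //; lra.
exists S; split=> [A B ABS|].
  by rewrite leqNgt; apply/negP => /(QS (A, B)); rewrite /= ABS.
by move: cS; rewrite setTD cardsT card_prod card_ord natrM expr2.
Qed.

(** * Bipartite graphs *)

Lemma disjoint_embeddings (A B : finType) n : (#|A| + #|B| <= n)%N ->
  exists (f : A -> 'I_n) (g : B -> 'I_n),
    [/\ injective f, injective g & forall a b, f a != g b].
Proof.
move=> le_n.
exists (fun a => widen_ord le_n (lshift #|B| (enum_rank a))).
exists (fun b => widen_ord le_n (rshift #|A| (enum_rank b))).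
split=> [a a' /(congr1 val)/= H|b b' /(congr1 val)/= /addnI H|a b].
- exact/enum_rank_inj/val_inj.
- exact/enum_rank_inj/val_inj.
- by rewrite -val_eqE /= neq_ltn ltn_addr.
Qed.

Section Bipartite.
Variables (A B T : finType) (f : A -> T) (g : B -> T).
Hypotheses (f_inj : injective f) (g_inj : injective g).
Hypothesis fg : forall a b, f a != g b.
Implicit Types (H : {set A * B}) (F : {set {set T}}) (a : A) (b : B).

Definition bip_edge (u : A * B) := [set f u.1; g u.2].
Definition bip H := [set bip_edge u | u in H].

Lemma bip_edge_inj : injective bip_edge.
Proof.
move=> [a b] [a' b'] E.
have : f a \in bip_edge (a', b') by rewrite -E !inE eqxx.
have : g b \in bip_edge (a', b') by rewrite -E !inE eqxx orbT.
rewrite !inE /= (negbTE (fg a b')) orbF (eq_sym (g b)) (negbTE (fg a' b)) /=.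
by rewrite !inj_eq // => /eqP-> /eqP->.
Qed.

Lemma card_bip H : #|bip H| = #|H|.
Proof. exact/card_imset/bip_edge_inj. Qed.

Lemma simple_bip H : simple_graph (bip H).
Proof. by move=> _ /imsetP[[a b] _ ->]; rewrite cards2 fg. Qed.

Lemma sub_bip H F : F \subset bip H -> exists2 H' : {set A * B}, H' \subset H & F = bip H'.
Proof.
move=> /subsetP FH; exists (bip_edge @^-1: F).
  apply/subsetP => u; rewrite inE => /FH/imsetP[u' u'H].
  by move/bip_edge_inj->.
apply/setP => e; apply/idP/imsetP => [eF|[u uF ->]]; last by rewrite inE in uF.
have /imsetP[u _ eu] := FH e eF.
by exists u => //; rewrite inE -eu.
Qed.

Lemma adj_bip H a b : adj (bip H) (f a) (g b) = ((a, b) \in H).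
Proof.
by rewrite /adj fg /= -[X in X \in bip H]/(bip_edge (a, b)) mem_imset //; apply: bip_edge_inj.
Qed.

Lemma adj_bipl H a y : adj (bip H) (f a) y -> exists2 b, y = g b & (a, b) \in H.
Proof.
case/andP => ay /imsetP[[a' b] abH E].
have : f a \in bip_edge (a', b) by rewrite -E !inE eqxx.
rewrite !inE /= (negbTE (fg a b)) orbF => /eqP/f_inj ?; subst a'.
have : y \in bip_edge (a, b) by rewrite -E !inE eqxx orbT.
by rewrite !inE /= eq_sym (negbTE ay) => /eqP->; exists b.
Qed.

Lemma adj_bipr H b x : adj (bip H) (g b) x -> exists2 a, x = f a & (a, b) \in H.
Proof.
case/andP => bx /imsetP[[a b'] abH E].
have : g b \in bip_edge (a, b') by rewrite -E !inE eqxx.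
rewrite !inE /= eq_sym (negbTE (fg a b)) /= => /eqP/g_inj ?; subst b'.
have : x \in bip_edge (a, b) by rewrite -E !inE eqxx orbT.
by rewrite !inE /= orbC eq_sym (negbTE bx) => /eqP->; exists a.
Qed.

Lemma cover_bip H a b : (a, b) \in H ->
  f a \in cover (bip H) /\ g b \in cover (bip H).
Proof.
move=> abH; have abE : bip_edge (a, b) \in bip H by apply: imset_f.
by split; apply/bigcupP; exists (bip_edge (a, b)); rewrite // !inE eqxx ?orbT.
Qed.

(** A walk between opposite sides has odd length, so a bound of 2 leaves only a single edge. *)
Lemma bip_diam2 H a b a' b' : diam_le (bip H) 2 ->
  (a, b) \in H -> (a', b') \in H -> (a, b') \in H.
Proof.
move=> dH /cover_bip[aH _] /cover_bip[_ bH].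
have [p [pP pl ps]] := diam_le_walk dH aH bH.
case: p pP pl ps => [|x [|y []]] //=.
- by move=> _ /eqP; rewrite (negbTE (fg _ _)).
- by rewrite andbT => ax xb _; rewrite -adj_bip -xb.
- case/and3P => /adj_bipl[c -> _] /adj_bipr[d -> _] _ /eqP.
  by rewrite (negbTE (fg _ _)).
Qed.

(** A walk between vertices on one side has even length, so a bound of 3 leaves length 2, which
    gives a common neighbour, or length 0, where [b] itself serves. *)
Lemma bip_diam3l H a b a' b' : diam_le (bip H) 3 ->
  (a, b) \in H -> (a', b') \in H -> exists2 c, (a, c) \in H & (a', c) \in H.
Proof.
move=> dH abH; have [aH _] := cover_bip abH; move=> /cover_bip[a'H _].
have [p [pP pl ps]] := diam_le_walk dH aH a'H.
case: p pP pl ps => [|x [|y [|z []]]] //=.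
- by move=> _ /f_inj<-; exists b.
- by rewrite andbT => /adj_bipl[c -> _] /eqP; rewrite eq_sym (negbTE (fg _ _)).
- rewrite andbT => /andP[/adj_bipl[c -> ac] cy] ya _; exists c => //.
  by rewrite -adj_bip adj_sym -ya.
- case/and4P => /adj_bipl[c -> _] /adj_bipr[d -> _] /adj_bipl[e -> _] _ /eqP.
  by rewrite eq_sym (negbTE (fg _ _)).
Qed.

Lemma bip_diam3r H a b a' b' : diam_le (bip H) 3 ->
  (a, b) \in H -> (a', b') \in H -> exists2 c, (c, b) \in H & (c, b') \in H.
Proof.
move=> dH abH; have [_ bH] := cover_bip abH; move=> /cover_bip[_ b'H].
have [p [pP pl ps]] := diam_le_walk dH bH b'H.
case: p pP pl ps => [|x [|y [|z []]]] //=.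
- by move=> _ /g_inj<-; exists a.
- by rewrite andbT => /adj_bipr[c -> _] /eqP; rewrite (negbTE (fg _ _)).
- rewrite andbT => /andP[/adj_bipr[c -> ac] cy] yb _; exists c => //.
  by rewrite -adj_bip -yb.
- case/and4P => /adj_bipr[c -> _] /adj_bipl[d -> _] /adj_bipr[e -> _] _ /eqP.
  by rewrite (negbTE (fg _ _)).
Qed.

(** A labelling of both sides that agrees along edges is constant on a connected part; it serves to
    identify the copy of $K_{s,s}$ containing a part. *)
Lemma bip_connected (X : Type) (cA : A -> X) (cB : B -> X) H d a b a' b' :
  (forall a b, (a, b) \in H -> cA a = cB b) -> diam_le (bip H) d ->
  (a, b) \in H -> (a', b') \in H -> cA a = cA a'.
Proof.
move=> cH dH /cover_bip[aH _] /cover_bip[a'H _].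
have [p [pP pl _]] := diam_le_walk dH aH a'H.
pose inv x := (forall d, x = f d -> cA d = cA a) /\
              (forall d, x = g d -> cB d = cA a).
have inv_a : inv (f a).
  by split=> e; [move/f_inj-> | move/eqP; rewrite (negbTE (fg _ _))].
suff inv_p x : path (adj (bip H)) x p -> inv x -> inv (last x p).
  by case: (inv_p _ pP inv_a) => /(_ a') + _ => /(_ (esym _)) H'; apply/esym/H'.
elim: p x {pP pl} => //= y p IHp x /andP[xy yP] [invf invg].
apply: IHp yP _; have yx := xy; rewrite adj_sym in yx; split=> e ye.
  rewrite ye in yx; have [c xc ec] := adj_bipl yx.
  by rewrite (cH _ _ ec) invg.
rewrite ye in yx; have [c xc ec] := adj_bipr yx.
by rewrite -(cH _ _ ec) invf.
Qed.

End Bipartite.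

Lemma le_Pdiam_bip (R : realType) n (eps : R) d (A B : finType)
    (S : {set A * B}) M :
  0 <= eps -> (0 < d)%N -> (#|A| + #|B| <= n)%N ->
  (forall f : A -> 'I_n, forall g : B -> 'I_n, injective f -> injective g ->
     (forall a b, f a != g b) ->
     forall H : {set A * B}, H \subset S -> diam_le (bip f g H) d ->
     (#|H| <= M)%N) ->
  #|S|%:R <= eps * n%:R ^+ 2 + (Pdiam n eps d)%:R * M%:R.
Proof.
move=> e0 d0 /disjoint_embeddings[f [g [f_inj g_inj fg]]] maxH.
rewrite -(card_bip f_inj g_inj fg); apply: le_Pdiam => //.
  exact: simple_bip.
move=> F /(sub_bip f_inj g_inj fg)[H HS ->] dH.
by rewrite card_bip // (maxH f g).
Qed.

(** By [bip_diam2] a part of diameter at most 2 contains the product of its two projections, and it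
    is always contained in that product. *)
Lemma le_Pdiam2 (R : realType) n m C (eps : R) (S : {set 'I_m * 'I_m}) :
  0 <= eps -> (2 * m <= n)%N ->
  (forall A B, setX A B \subset S -> (#|A| * #|B| <= C * m)%N) ->
  #|S|%:R <= eps * n%:R ^+ 2 + (Pdiam n eps 2)%:R * (C * m)%:R.
Proof.
move=> e0 mn maxAB; apply: le_Pdiam_bip => //; first by rewrite !card_ord; lia.
move=> f g f_inj g_inj fg H HS dH.
pose A := [set u.1 | u in H]; pose B := [set u.2 | u in H].
have AB u : u \in setX A B -> u \in H.
  case: u => _ _ /setXP[/imsetP[[a b] abH ->] /imsetP[[a' b'] abH' ->]] /=.
  exact: (bip_diam2 f_inj g_inj fg dH abH abH').
apply: leq_trans (maxAB A B _); last first.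
  by apply/subsetP => u /AB; apply: (subsetP HS).
rewrite -cardsX; apply/subset_leq_card/subsetP => u uH.
by rewrite inE !imset_f.
Qed.

(** The host is the union of [k] disjoint copies of $K_{s,s}$. A part is connected, hence lies in
    one copy, and forgetting the copy index is injective on it. *)
Lemma le_Pdiam4 (R : realType) n k s (eps : R) :
  0 <= eps -> (2 * (k * s) <= n)%N ->
  (k * s ^ 2)%:R <= eps * n%:R ^+ 2 + (Pdiam n eps 4)%:R * (s ^ 2)%:R.
Proof.
move=> e0 ksn; pose A := ('I_k * 'I_s)%type.
pose S := [set u : A * A | u.1.1 == u.2.1].
have <- : #|S| = (k * s ^ 2)%N.
  pose h (w : 'I_k * ('I_s * 'I_s)) : A * A := ((w.1, w.2.1), (w.1, w.2.2)).
  have h_inj : injective h by move=> [i [x y]] [j [z t]] [-> -> _ ->].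
  rewrite -mulnn -[LHS](_ : #|h @: setT| = _); last first.
    apply: eq_card => -[[i x] [j y]]; rewrite inE /=.
    apply/imsetP/eqP => [[[l [z t]] _ [-> _ -> _]] //|->].
    by exists (j, (x, y)).
  by rewrite card_imset // cardsT !card_prod !card_ord.
apply: le_Pdiam_bip => //; first by rewrite card_prod !card_ord; lia.
move=> f g f_inj g_inj fg H HS dH.
have cH a b : (a, b) \in H -> a.1 = b.1.
  by move=> /(subsetP HS); rewrite inE => /eqP.
have [->|/set0Pn[[a0 b0] H0]] := eqVneq H set0; first by rewrite cards0.
have in_H a b : (a, b) \in H -> a.1 = a0.1 /\ b.1 = a0.1.
  move=> abH; rewrite -(cH _ _ abH).
  by have := bip_connected f_inj g_inj fg cH dH abH H0.
pose pr (u : A * A) := (u.1.2, u.2.2).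
rewrite -mulnn -[X in (_ <= X * X)%N]card_ord -card_prod -cardsT.
rewrite -(_ : #|pr @: H| = #|H|); first exact/subset_leq_card/subsetT.
apply: card_in_imset => -[[i x] [j y]] [[i' x'] [j' y']].
by move=> /in_H[/= -> ->] /in_H[/= -> ->] [-> ->].
Qed.

(** * Diameters 2 and 4 *)

Lemma truncnS_itv (R : realType) (x : R) : 0 <= x ->
  x < (Num.truncn x).+1%:R <= x + 1.
Proof.
by move=> /truncn_itv/andP[xl ->]; rewrite -natr1 lerD2r.
Qed.

(** The Bernoulli-type bound [p ^+ k * (1 + k%:R * d) <= 1] makes any [k] above [(x * d)^-1]
    sufficient. *)
Lemma exists_expr_le (R : realType) (p x : R) :
  0 < p -> p < 1 -> 0 < x -> exists k, p ^+ k <= x.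
Proof.
move=> p0 p1 x0; pose d := 1 - p.
have pE k : p ^+ k * (1 + k%:R * d) <= 1.
  elim: k => [|k IHk]; first by rewrite mul0r addr0 mulr1.
  apply: le_trans IHk; rewrite exprSr -mulrA ler_pM2l ?exprn_gt0 //.
  rewrite -natr1 -subr_ge0.
  have -> : 1 + k%:R * d - p * (1 + (k%:R + 1) * d) = (k%:R + 1) * d ^+ 2.
    by rewrite /d; ring.
  by rewrite mulr_ge0 ?sqr_ge0 // addr_ge0.
have d0 : 0 < d by rewrite subr_gt0.
have /truncnS_itv/andP[] : 0 <= (x * d)^-1 by rewrite invr_ge0 mulr_ge0 ?ltW.
set k := (Num.truncn _).+1 => kx _; exists k.
have xk : 1 <= x * (k%:R * d).
  by rewrite mulrCA mulrC -ler_pdivrMl ?mulr_gt0 // mulr1 ltW.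
have pk := pE k; have pk0 : 0 < p ^+ k by rewrite exprn_gt0.
rewrite -(ler_pM2r (_ : 0 < k%:R * d)) ?mulr_gt0 ?ltr0n //.
by apply: le_trans xk; apply: le_trans pk; rewrite ler_pM2l // lerDr.
Qed.

Lemma Pdiam2_linear (R : realType) (eta : R) : 0 < eta ->
  exists c C : R, [/\ 0 < c, 0 < C &
    exists N : nat, forall n : nat, (N <= n)%N ->
      forall eps : R, 0 <= eps -> eps <= 1 / 4 - eta ->
        c * n%:R <= (Pdiam n eps 2)%:R /\
        (Pdiam n eps 2)%:R <= C * n%:R].
Proof.
(* This choice gives $2(1 - p) = \eta/(1 + \eta) \le \eta$, so the random bipartite graph misses at
   most $\eta m^2$ pairs, and [p] stays positive for every [eta]. *)
move=> eta0; pose p : R := 1 - eta / (2 * (1 + eta)).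
have eta1 : 0 < 2 * (1 + eta) by lra.
have pE : (1 - p) * (2 * (1 + eta)) = eta by rewrite /p subKr divfK ?gt_eqF.
have p1 : p < 1 by nra.
have p0 : 0 < p by nra.
have pd : 2 * (1 - p) <= eta by nra.
have [C pC] := @exists_expr_le R p 16^-1 p0 p1 ltac:(lra).
exists (eta / C.+1%:R), 1; split=> //; first by rewrite divr_gt0.
(* The threshold ensures $\eta n \ge 2$, which absorbs the rounding in [m := n./2]. *)
exists (Num.truncn (2 / eta)).+3 => n nN eps e0 e1; split; last first.
  by rewrite mul1r ler_nat Pdiam2_le.
have {nN} n_ge : 2 <= eta * n%:R.
  rewrite mulrC -ler_pdivrMr //.
  have /truncnS_itv/andP[/ltW/le_trans + _] : 0 <= 2 / eta by rewrite divr_ge0 // ltW.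
  by apply; rewrite ler_nat; lia.
have n0 : (1 < n)%N by rewrite -(ltr_nat R); nra.
pose m := n./2; have m0 : (0 < m)%N by rewrite half_gt0.
have [S [maxAB cS]] := exists_biclique_free p0 p1 pC m0.
have mn : (2 * m <= n)%N by lia.
have nm : (n <= 2 * m + 1)%N by lia.
have := le_Pdiam2 e0 mn maxAB.
have : #|S|%:R = m%:R ^+ 2 - #|~: S|%:R :> R.
  by rewrite -natrX -mulnn -[X in (X * X)%N]card_ord -card_prod -(cardsC S) natrD addrK.
move: mn nm m0 n0; rewrite -!(ler_nat R) natrD natrM.
move=> mn nm m0 n0 -> leP.
rewrite mulrAC ler_pdivrMr ?ltr0n // -natr1.
rewrite !natrM in leP.
have P0 : 0 <= (Pdiam n eps 2)%:R * C%:R :> R by rewrite mulr_ge0.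
have C0 : 0 <= (Pdiam n eps 2)%:R :> R by [].
move: m%:R n%:R #|~: S|%:R (Pdiam _ _ _)%:R C%:R mn nm m0 n0 leP n_ge cS P0 C0.
move=> u v c P C' uv vu u1 v2 leP v_ge cS P0 C0.
have h1 : c <= eta * u ^+ 2.
  by apply: le_trans cS _; rewrite ler_wpM2r // sqr_ge0.
have h2 : eps * v ^+ 2 <= (1 / 4 - eta) * v ^+ 2 by rewrite ler_wpM2r // sqr_ge0.
have h3 : (v - 1) ^+ 2 <= (2 * u) ^+ 2 by rewrite ler_sqr ?nnegrE; lra.
(* The factor [1 - eta] is nonnegative because $0 \le \epsilon \le 1/4 - \eta$ forces $\eta \le
   1/4$. *)
have h4 : 0 <= (1 - eta) * ((2 * u) ^+ 2 - (v - 1) ^+ 2).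
  by rewrite mulr_ge0 // subr_ge0 //; lra.
have h5 : 0 <= v * (eta * v - 2) by rewrite mulr_ge0 ?subr_ge0 //; lra.
have h6 : 0 <= eta * (2 * v - 1) by rewrite mulr_ge0 //; lra.
have h7 : 0 <= (P * C') * (v - 2 * u) by rewrite mulr_ge0 // subr_ge0.
apply: (@le_trans _ _ (P * C')); last by lra.
rewrite -(ler_pM2r (_ : 0 < v)); last by lra.
by lra.
Qed.

Lemma Pdiam4_lower (R : realType) n (eps : R) : (0 < n)%N ->
  n%:R^-1 <= eps -> eps <= 18^-1 -> 72^-1 / eps <= (Pdiam n eps 4)%:R.
Proof.
move=> n0 ne e1.
have n0R : 0 < n%:R :> R by rewrite ltr0n.
have e0 : 0 < eps by apply: lt_le_trans ne; rewrite invr_gt0.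
have {}ne : 1 <= eps * n%:R by rewrite -ler_pdivrMr // div1r.
have /truncnS_itv/andP[] : 0 <= 8 * (eps * n%:R) by rewrite !mulr_ge0 // ltW.
set s := (Num.truncn _).+1 => s_gt s_le.
pose k := (n %/ (2 * s))%N.
have sn : (2 * s <= n)%N by rewrite -(ler_nat R) natrM; nra.
have k0 : (0 < k)%N by rewrite divn_gt0.
have ksn : (2 * (k * s) <= n)%N by rewrite mulnCA leq_divM.
have nk : (n < 4 * (s * k))%N.
  have : (n < k.+1 * (2 * s))%N by rewrite -ltn_divLR.
  by nia.
have := le_Pdiam4 (ltW e0) ksn; rewrite natrM natrX.
move: nk; rewrite -(ltr_nat R) !natrM.
have : 0 < k%:R :> R by rewrite ltr0n.
have : 0 < s%:R :> R by rewrite ltr0n.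
move: s%:R k%:R (Pdiam _ _ _)%:R n%:R n0R ne s_gt s_le.
move=> {k0} s' k' P m m0 em s_gt s_le s0 k0 mk le_P.
(* Since $8\epsilon n < s$ and $n < 4sk$, the exceptional part has at most $ks^2/2$ edges, half of
   the total. *)
have kP : k' <= 2 * P.
  rewrite -(ler_pM2r (exprn_gt0 2 s0)).
  have : eps * m ^+ 2 <= s' / 8 * (4 * (s' * k')).
    rewrite expr2 mulrA; apply: ler_pM; rewrite ?mulr_ge0 ?ltW //; lra.
  by lra.
rewrite ler_pdivrMr //.
suff : m <= m * (72 * (P * eps)) by rewrite ler_pMr //; lra.
apply: le_trans (ltW mk) _.
have : s' * k' <= (9 * (eps * m)) * (2 * P).
  by apply: ler_pM; lra.
by lra.
Qed.

Lemma Pdiam4_upper (R : realType) n (eps : R) :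
  0 < eps -> eps <= 1 -> (Pdiam n eps 4)%:R <= 2 / eps.
Proof.
move=> e0 e1; have i1 : 1 <= eps^-1 by rewrite -invr1 lef_pV2 ?posrE.
have /truncnS_itv/andP[] : 0 <= eps^-1 / 2 by lra.
set l := (Num.truncn _).+1 => l_gt l_le.
apply: (@le_trans _ _ l%:R); last by lra.
rewrite ler_nat; apply: Pdiam4_le => //; first exact: ltW.
by rewrite -ler_pdivrMr // mul1r; lra.
Qed.

Lemma Pdiam3_upper (R : realType) n (eps : R) :
  0 < eps -> eps <= 1 -> (Pdiam n eps 3)%:R <= 2 / eps ^+ 2.
Proof.
move=> e0 e1; have e2 : 0 < eps ^+ 2 by rewrite exprn_gt0.
have i1 : 1 <= (eps ^+ 2)^-1.
  by rewrite -invr1 lef_pV2 ?posrE // expr_le1 // ltW.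
have /truncnS_itv/andP[] : 0 <= (eps ^+ 2)^-1 / 8 by lra.
set l := (Num.truncn _).+1 => l_gt l_le.
apply: (@le_trans _ _ l%:R); last by lra.
rewrite ler_nat; apply: Pdiam3_le => //; first exact: ltW.
by rewrite -ler_pdivrMr // mul1r; lra.
Qed.

(** * Degenerate and regular projective planes *)

Section ProjectivePlanes.
Local Open Scope nat_scope.

Definition pencil (P L : finType) (H : {set P * L}) x := [set l | (x, l) \in H].
Definition points (P L : finType) (H : {set P * L}) l := [set x | (x, l) \in H].
Definition transpose (P L : finType) (H : {set P * L}) :=
  [set u : L * P | (u.2, u.1) \in H].

(** Equivalently, the bipartite incidence graph has no 4-cycle. *)
Definition partial_linear (P L : finType) (H : {set P * L}) :=
  forall x x' l l', (x, l) \in H -> (x', l) \in H -> (x, l') \in H ->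
    (x', l') \in H -> x != x' -> l = l'.

(** Only points and lines occurring in some incidence are constrained, and degenerate planes are
    allowed, as these are the properties that a part of diameter 3 inherits. *)
Definition projective (P L : finType) (H : {set P * L}) := [/\
  forall x l x' l', (x, l) \in H -> (x', l') \in H ->
    exists2 m, (x, m) \in H & (x', m) \in H,
  forall x l x' l', (x, l) \in H -> (x', l') \in H ->
    exists2 z, (z, l) \in H & (z, l') \in H
  & partial_linear H].

Lemma projective_transpose (P L : finType) (H : {set P * L}) :
  projective H -> projective (transpose H).
Proof.
case=> joinH meetH linH; split.
- move=> l x l' x'; rewrite !inE /= => xl xl'.
  by have [z] := meetH _ _ _ _ xl xl'; exists z; rewrite inE.
- move=> l x l' x'; rewrite !inE /= => xl xl'.
  by have [m] := joinH _ _ _ _ xl xl'; exists m; rewrite inE.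
- move=> l l' x x'; rewrite !inE /= => xl xl' x'l x'l' ll'.
  apply/eqP/negPn/negP => /(linH _ _ _ _ xl x'l xl' x'l') lE.
  by rewrite lE eqxx in ll'.
Qed.

Lemma points_transpose (P L : finType) (H : {set P * L}) x :
  points (transpose H) x = pencil H x.
Proof. by apply/setP => l; rewrite !inE. Qed.

Lemma pencil_transpose (P L : finType) (H : {set P * L}) l :
  pencil (transpose H) l = points H l.
Proof. by apply/setP => x; rewrite !inE. Qed.

Lemma card_transpose (P L : finType) (H : {set P * L}) : #|transpose H| = #|H|.
Proof.
pose sw (u : L * P) := (u.2, u.1).
have sw_inj : injective sw by move=> [a b] [c d] [-> ->].
rewrite -(card_imset _ sw_inj); apply: eq_card => -[x l].
apply/imsetP/idP => [[[m z]]|xl]; first by rewrite inE /= => mz [-> ->].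
by exists (l, x); rewrite // inE.
Qed.

(* The lines through [x] meet [l] in distinct points. *)
Lemma pencil_le_points (P L : finType) (H : {set P * L}) x l x1 l1 :
  projective H -> (x, l1) \in H -> (x1, l) \in H -> (x, l) \notin H ->
  #|pencil H x| <= #|points H l|.
Proof.
move=> [joinH meetH linH] xl1 x1l xl.
pose meet m := odflt x [pick z | ((z, m) \in H) && ((z, l) \in H)].
have meetP m : (x, m) \in H -> (meet m, m) \in H /\ (meet m, l) \in H.
  move=> xm; rewrite /meet; case: pickP => [z /andP[]|none] //=.
  by have [z zm zl] := meetH _ _ _ _ xm x1l; have := none z; rewrite zm zl.
rewrite -(@card_in_imset _ _ meet); last first.
  move=> m m'; rewrite !inE => xm xm' eq_meet.
  have [mm ml] := meetP m xm; have [mm' _] := meetP m' xm'.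
  rewrite -eq_meet in mm'; apply: (linH x (meet m)) => //.
  by apply: contraNneq xl => ->.
apply/subset_leq_card/subsetP => _ /imsetP[m + ->].
by rewrite !inE => /meetP[].
Qed.

Lemma points_le_pencil (P L : finType) (H : {set P * L}) x l x1 l1 :
  projective H -> (x, l1) \in H -> (x1, l) \in H -> (x, l) \notin H ->
  #|points H l| <= #|pencil H x|.
Proof.
move=> pH xl1 x1l xl; rewrite -points_transpose -pencil_transpose.
apply: (pencil_le_points (x1 := l1) (l1 := x1) (projective_transpose pH));
  by rewrite inE.
Qed.

Lemma card_pencil_cover (P L : finType) (H : {set P * L}) x :
  #|[set u in H | u.1 == x]| = #|pencil H x|.
Proof.
have inj : injective (fun l : L => (x, l)) by move=> l m [].
rewrite -(card_imset _ inj); apply: eq_card => -[y l]; rewrite !inE /=.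
apply/andP/imsetP => [[yl /eqP yx]|[m]]; last by rewrite inE => xm [-> ->].
by exists l; rewrite ?inE -yx.
Qed.

Lemma card_points_cover (P L : finType) (H : {set P * L}) l :
  #|[set u in H | u.2 == l]| = #|points H l|.
Proof.
rewrite -pencil_transpose -card_pencil_cover -[LHS]card_transpose.
by apply: eq_card => -[m x]; rewrite !inE.
Qed.

(* All points except at most one lie on [l0]. *)
Lemma card_degenerate (P L : finType) (H : {set P * L}) D x0 l0 x1 l1 :
  projective H -> (forall x, #|pencil H x| <= D) ->
  (forall l, #|points H l| <= D) -> (x0, l1) \in H -> (x1, l0) \in H ->
  #|pencil H x0| < #|points H l0| -> #|H| <= 4 * D.
Proof.
move=> pH maxP maxL xl1 xl0 lt_deg; have [joinH meetH linH] := pH.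
have x0l0 : (x0, l0) \in H.
  apply: contraLR lt_deg => /(points_le_pencil pH xl1 xl0).
  by rewrite -leqNgt.
(* Otherwise the degree comparisons for the three non-incident pairs give $|l_0| \le \deg z \le |l|
   \le \deg x_0$, against the strict inequality assumed. *)
have off z m y l : (z, m) \in H -> (y, l) \in H ->
    (z, l0) \notin H -> (x0, l) \notin H -> (z, l) \in H.
  move=> zm yl zl0 x0l; apply/negPn/negP => zl.
  have := points_le_pencil pH zm x0l0 zl0.
  have := pencil_le_points pH zm yl zl.
  have := points_le_pencil pH x0l0 yl x0l.
  by lia.
have line_z y z l : (y, l0) \in H -> y != x0 -> (z, l0) \notin H ->
    (y, l) \in H -> (z, l) \in H -> (x0, l) \notin H.
  move=> yl0 yx0 zl0 yl zl; apply/negP => x0l.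
  by case/negP: zl0; rewrite (linH y x0 l0 l).
(* Besides [x0], the line [l0] has two further points [y] and [y']. Their joins with [z] avoid [x0],
   so by [off] both contain [z'] and they coincide; the common line contains [y] and [y'], so it is
   [l0], although [z] is off [l0]. *)
have uniq_off z m z' m' : (z, m) \in H -> (z', m') \in H ->
    (z, l0) \notin H -> (z', l0) \notin H -> z = z'.
  move=> zm zm' zl0 zl0'; apply/eqP/negPn/negP => zz'.
  have [l2 x0l2 zl2] := joinH _ _ _ _ x0l0 zm.
  have : 1 < #|pencil H x0|.
    apply/card_gt1P; exists l0, l2; rewrite !inE; split=> //.
    by apply: contraNneq zl0 => ->.
  move=> gt1; have : 1 < #|points H l0 :\ x0|.
    by move: lt_deg; rewrite (cardsD1 x0 (points H l0)) inE x0l0; lia.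
  case/card_gt1P => y [y' []]; rewrite !inE.
  move=> /andP[yx0 yl0] /andP[yx0' yl0'] yy'.
  have [l yl zl] := joinH _ _ _ _ yl0 zm.
  have [l' yl' zl'] := joinH _ _ _ _ yl0' zm.
  have x0l := line_z _ _ _ yl0 yx0 zl0 yl zl.
  have x0l' := line_z _ _ _ yl0' yx0' zl0 yl' zl'.
  have z'l := off _ _ _ _ zm' yl zl0' x0l.
  have z'l' := off _ _ _ _ zm' yl' zl0' x0l'.
  have ll' : l = l' by apply: (linH z z').
  rewrite -ll' in yl'; case/negP: zl0.
  by rewrite (linH y y' l0 l).
case: (pickP (fun z => ((z, l0) \notin H) && [exists m, (z, m) \in H])).
  move=> z /andP[zl0 /existsP[m zm]].
  (* [W] collects the incidences of points of [l0] with lines other than [l0] through [z]. Such a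
     line meets [l0] only once, so [W] injects into the pencil of [z]. *)
  pose W := [set u in H | [&& u.2 != l0, (u.1, l0) \in H & (z, u.2) \in H]].
  have sub : H \subset [set u in H | u.1 == z] :|: [set u in H | u.1 == x0]
                   :|: [set u in H | u.2 == l0] :|: W.
    apply/subsetP => -[x l] xl; rewrite !inE xl /=.
    have [_|xz] := eqVneq x z; first by [].
    have [_|xx0] := eqVneq x x0; first by [].
    have [_|ll0] := eqVneq l l0; first by rewrite ?orbT.
    have xl0' : (x, l0) \in H.
      by apply: contraNT xz => xl0'; rewrite (uniq_off _ _ _ _ xl zm).
    rewrite xl0' /=; apply: (off _ _ _ _ zm xl) => //.
    by apply: contraNN ll0 => x0l; rewrite (linH x x0 l l0).
  have cW : #|W| <= D.
    apply: leq_trans (maxP z).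
    rewrite -(@card_in_imset _ _ snd); last first.
      move=> [x l] [x' l']; rewrite !inE /=.
      move=> /and4P[xl ll0 xl0' _] /and4P[xl' _ xl0'' _] ll'; congr pair => //.
      rewrite -ll' in xl'; apply: contraNeq ll0 => xx'.
      by rewrite (linH x x' l l0).
    apply/subset_leq_card/subsetP => _ /imsetP[[x l] + ->].
    by rewrite !inE => /and4P[].
  have c1 := card_pencil_cover H z; have c2 := card_pencil_cover H x0.
  have c3 := card_points_cover H l0.
  have m1 := maxP z; have m2 := maxP x0; have m3 := maxL l0.
  apply: leq_trans (subset_leq_card sub) _.
  apply: leq_trans (leq_card_setU _ _).1 _.
  apply: leq_trans (leq_add (leq_card_setU _ _).1 (leqnn _)) _.
  apply: leq_trans (leq_add (leq_add (leq_card_setU _ _).1 (leqnn _)) (leqnn _)) _.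
  by rewrite c1 c2 c3; lia.
move=> none.
have all_on x l : (x, l) \in H -> (x, l0) \in H.
  move=> xl; apply/negPn/negP => xl0'; have := none x.
  by rewrite xl0' /= => /negbT/existsP[]; exists l.
(* Now all points lie on [l0]. A second line [l2] then has the single point [x2], and every line
   must meet [l2] there. *)
case: (pickP (fun u => (u \in H) && (u.2 != l0))) => [[x2 l2]|none2].
  move=> /= /andP[xl2 ll2].
  have sub : H \subset [set u in H | u.1 == x2] :|: [set u in H | u.2 == l0].
    apply/subsetP => -[x l] xl; rewrite !inE xl /=.
    have [_|ll0] := eqVneq l l0; first by rewrite ?orbT.
    have [w wl wl2] := meetH _ _ _ _ xl xl2.
    have wl0 := all_on _ _ wl.
    have wx2 : w = x2.
      apply: contraNeq ll2 => wx2; by rewrite (linH w x2 l2 l0) // (all_on _ _ xl2).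
    rewrite orbF -wx2; apply: contraNT ll0 => xw.
    by rewrite (linH x w l l0) // (all_on _ _ xl).
  apply: leq_trans (subset_leq_card sub) _.
  apply: leq_trans (leq_card_setU _ _).1 _.
  rewrite card_pencil_cover card_points_cover.
  by have := maxP x2; have := maxL l0; lia.
have sub : H \subset [set u in H | u.2 == l0].
  apply/subsetP => u uH; rewrite inE uH; have := none2 u.
  by rewrite uH /= => /negbT/negPn.
apply: leq_trans (subset_leq_card sub) _.
by rewrite card_points_cover; have := maxL l0; lia.
Qed.

(** Unless [card_degenerate] applies to [H] or to its dual, all points and lines have the same
    degree [k]. The [k] lines through one point then cover all points, so there are at most $k^2$
    points. *)
Lemma card_projective (P L : finType) (H : {set P * L}) D :
  projective H -> (forall x, #|pencil H x| <= D) ->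
  (forall l, #|points H l| <= D) ->
  #|H| <= 4 * D \/
  exists k, [/\ #|H| = k * #|fst @: H|, #|H| <= k ^ 3 &
    forall x l, (x, l) \in H -> #|points H l| = k].
Proof.
move=> pH maxP maxL; have [joinH _ _] := pH.
have [->|/set0Pn[[x0 l0] xl0]] := eqVneq H set0; first by left; rewrite cards0.
have [|largeH] := leqP #|H| (4 * D); first by left.
have same x l x1 l1 : (x, l1) \in H -> (x1, l) \in H ->
    #|pencil H x| = #|points H l|.
  move=> xl1 x1l; apply/eqP; rewrite eqn_leq.
  apply/andP; split; rewrite leqNgt; apply/negP => lt_deg; last first.
    by have := card_degenerate pH maxP maxL xl1 x1l lt_deg; rewrite leqNgt largeH.
  move: largeH; rewrite -card_transpose ltnNge => /negP; apply.
  apply: (@card_degenerate _ _ _ D l x l1 x1 (projective_transpose pH));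
    rewrite ?inE ?pencil_transpose ?points_transpose // => y.
    by rewrite pencil_transpose.
  by rewrite points_transpose.
have degP x l : (x, l) \in H -> #|pencil H x| = #|pencil H x0|.
  by move=> xl; rewrite (same _ _ _ _ xl xl0) (same _ _ _ _ xl0 xl0).
have degL x l : (x, l) \in H -> #|points H l| = #|pencil H x0|.
  by move=> xl; rewrite (same _ _ _ _ xl0 xl).
have cardH : #|H| = #|pencil H x0| * #|fst @: H|.
  rewrite -sum1_card (partition_big fst (mem (fst @: H))) /=; last first.
    by move=> u uH; apply: imset_f.
  rewrite mulnC -sum_nat_const; apply: eq_bigr => x /imsetP[[y l] yl ->] /=.
  rewrite sum1_card -(degP _ _ yl) -card_pencil_cover.
  by apply: eq_card => u; rewrite !inE.
right; exists #|pencil H x0|; split=> //.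
rewrite cardH expnS leq_mul2l; apply/orP; right.
have sub : fst @: H \subset \bigcup_(l in pencil H x0) points H l.
  apply/subsetP => _ /imsetP[[x l] xl ->] /=.
  have [m x0m xm] := joinH _ _ _ _ xl0 xl.
  by apply/bigcupP; exists m; rewrite inE.
apply: leq_trans (subset_leq_card sub) _.
apply: leq_trans (leq_card_bigcup _ _) _; rewrite -mulnn -sum_nat_const.
by apply: leq_sum => l; rewrite inE => /degL->.
Qed.

End ProjectivePlanes.

(** * Planes in random incidence structures *)

Section Incidence.
Variable F : finFieldType.

Definition incidence := [set u : (F * F) * (F * F) | u.1.2 + u.2.2 == u.2.1 * u.1.1].

Lemma card_incidence : #|incidence| = (#|F| ^ 3)%N.
Proof.
pose h (w : F * (F * F)) := ((w.1, w.2.1), (w.2.2, w.2.2 * w.1 - w.2.1)).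
have h_inj : injective h by move=> [x [y a]] [x' [y' a']] [-> -> -> _].
have -> : incidence = h @: setT.
  apply/setP => -[[x y] [a b]]; rewrite inE /=.
  apply/eqP/imsetP => [E|[[x' [y' a']] _ [-> -> -> ->]]]; last by rewrite /= addrC subrK.
  by exists (x, (y, a)); rewrite // /h /= -E addrC addKr.
by rewrite card_imset // cardsT !card_prod expnS -mulnn.
Qed.

(** The four incidence equations combine to $(a - a')(x - x') = 0$. *)
Lemma incidence_linear : partial_linear incidence.
Proof.
move=> [x y] [x' y'] [a b] [a' b']; rewrite !inE /=.
move=> /eqP E1 /eqP E2 /eqP E3 /eqP E4 xx'.
have : (a - a') * (x - x') = 0.
  have -> : (a - a') * (x - x') = (a * x - a' * x) - (a * x' - a' * x') by ring.
  by rewrite -E1 -E2 -E3 -E4; ring.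
move/eqP; rewrite mulf_eq0 !subr_eq0 => /orP[/eqP aa'|/eqP ex].
  by congr pair => //; apply: (addrI y); rewrite E1 E3 aa'.
case/eqP: xx'; congr pair => //; apply: (addIr b).
by rewrite E1 E2 ex.
Qed.

Lemma card_pencil_incidence u : (#|pencil incidence u| <= #|F|)%N.
Proof.
case: u => x y; pose h a : F * F := (a, a * x - y).
have h_inj : injective h by move=> a b [].
rewrite -cardsT -(card_imset _ h_inj); apply/subset_leq_card/subsetP => -[a b].
by rewrite !inE /= => /eqP E; apply/imsetP; exists a; rewrite // /h -E addrC addKr.
Qed.

Lemma card_points_incidence u : (#|points incidence u| <= #|F|)%N.
Proof.
case: u => a b; pose h x : F * F := (x, a * x - b).
have h_inj : injective h by move=> x y [].
rewrite -cardsT -(card_imset _ h_inj); apply/subset_leq_card/subsetP => -[x y].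
by rewrite !inE /= => /eqP E; apply/imsetP; exists x; rewrite // /h -E addrK.
Qed.
End Incidence.

Lemma pencilS (P L : finType) (H S : {set P * L}) x :
  H \subset S -> pencil H x \subset pencil S x.
Proof. by move=> /subsetP HS; apply/subsetP => l; rewrite !inE => /HS. Qed.

Lemma pointsS (P L : finType) (H S : {set P * L}) l :
  H \subset S -> points H l \subset points S l.
Proof. by move=> /subsetP HS; apply/subsetP => x; rewrite !inE => /HS. Qed.

Lemma sum_expr_card (R : comNzRingType) (T : finType) (t : R) :
  \sum_(A : {set T}) t ^+ #|A| = (1 + t) ^+ #|T|.
Proof.
rewrite addrC -[in RHS]cardsT -prodr_const.
rewrite (eq_bigl predT) => [|x]; last by rewrite inE.
rewrite (bigA_distr _ _ (fun=> t) (fun=> 1)).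
by apply: eq_bigr => A _; rewrite -big_mkcond /= prodr_const.
Qed.

(** A Bernoulli-type inequality in product form; for $nt < 1$ it bounds $(1 + t)^n$ by $1/(1 -
    nt)$. *)
Lemma expr1D_le (R : realFieldType) (t : R) n :
  0 <= t -> (1 + t) ^+ n * (1 - n%:R * t) <= 1.
Proof.
move=> t0; elim: n => [|n IHn]; first by rewrite mul0r subr0 mulr1.
apply: le_trans IHn; rewrite exprSr -mulrA ler_wpM2l ?exprn_ge0 ?addr_ge0 //.
rewrite -natr1 -subr_ge0.
have -> : 1 - n%:R * t - (1 + t) * (1 - (n%:R + 1) * t) = (n%:R + 1) * t ^+ 2 by ring.
by rewrite mulr_ge0 ?sqr_ge0 // addr_ge0.
Qed.

(* For a projective H in which every line has at least two points, the
   incidences spanned by the point set of H are exactly those of H. *)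
Definition spanned (P L : finType) (I : {set P * L}) (A : {set P}) :=
  [set u in I | (u.1 \in A) && [exists x in A, (x != u.1) && ((x, u.2) \in I)]].

(** A line of [I] through two points of [H] equals, by linearity of [I], the line joining them in
    [H]. *)
Lemma spanned_sub (P L : finType) (I H : {set P * L}) :
  partial_linear I -> projective H -> H \subset I ->
  spanned I (fst @: H) \subset H.
Proof.
move=> linI [joinH _ _] /subsetP HI; apply/subsetP => -[x l]; rewrite !inE /=.
case/and3P => xl /imsetP[[y m] ym /= xy] /existsP[z /and3P[]].
case/imsetP => -[z' m'] zm /= zz' zy zl; subst x z'.
have [c yc zc] := joinH _ _ _ _ ym zm.
by rewrite (linI z y l c) // HI.
Qed.

Lemma sub_spanned (P L : finType) (I H : {set P * L}) :
  H \subset I -> (forall x l, (x, l) \in H -> (1 < #|points H l|)%N) ->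
  H \subset spanned I (fst @: H).
Proof.
move=> /subsetP HI big; apply/subsetP => -[x l] xl; rewrite !inE /= HI //=.
apply/andP; split; first by apply/imsetP; exists (x, l).
have := big x l xl; rewrite (cardsD1 x) inE xl ltnS => /card_gt0P[y].
rewrite !inE => /andP[yx yl]; apply/existsP; exists y.
by rewrite yx HI //= andbT; apply/imsetP; exists (y, l).
Qed.

(** Degenerate planes and planes with [k < K] have at most [M] incidences. The remaining ones are
    avoided by random choice: with $t = (3/4)^K$ the nonempty point sets contribute at most $(1 +
    t)^{q^2} - 1 \le 1/3$, where $q = |F|$ and $q^2t \le 1/4$. The density 3/4 loses at most half of
    the incidences. *)
Lemma exists_planeless (R : realType) (F : finFieldType) K M :
  (1 < K)%N -> (4 * #|F| <= M)%N -> (K ^ 3 <= M)%N ->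
  4 * #|F|%:R ^+ 2 * (3 / 4) ^+ K <= 1 :> R ->
  exists S : {set (F * F) * (F * F)}, [/\ partial_linear S,
    (#|F| ^ 3 <= 2 * #|S|)%N &
    forall H : {set (F * F) * (F * F)}, H \subset S -> projective H ->
      (#|H| <= M)%N].
Proof.
move=> K1 qM KM qK; set I := incidence F; pose p : R := 3 / 4.
have p0 : 0 < p by rewrite /p; lra.
have p1 : p < 1 by rewrite /p; lra.
(* The events are indexed by point sets rather than by planes, since [spanned] recovers a plane from
   its points; this keeps the union bound small. *)
pose Q (A : {set F * F}) := (A != set0) && (K * #|A| <= #|spanned I A|)%N.
have [|S [QS cS]] := @exists_avoiding R _ p p0 p1 _ Q (spanned I) I.
  set t := p ^+ K; have t0 : 0 <= t by rewrite exprn_ge0 // ltW.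
  apply: (@le_lt_trans _ _ (\sum_(A : {set F * F} | A != set0) t ^+ #|A|)).
    rewrite big_mkcond [leRHS]big_mkcond /=; apply: ler_sum => A _.
    rewrite /Q; case: (A != set0) => //=; case: ifP => KA; last exact: exprn_ge0.
    by rewrite /t -exprM ler_wiXn2l // ltW.
  have := sum_expr_card (F * F)%type t; rewrite (bigD1 set0) //= cards0 expr0.
  have := expr1D_le #|{: F * F}| t0; rewrite card_prod.
  have : (#|F| * #|F|)%:R * t <= 1 / 4.
    by rewrite natrM; rewrite -/p -/t in qK; lra.
  move: (_%:R * t) (\sum_(_ | _) _) ((1 + t) ^+ _) => u s w u4 wu sw.
  have w0 : 0 <= w - 1 \/ w < 1 by case: (lerP 1 w); rewrite ?subr_ge0; auto.
  by case: w0 => w0; nra.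
exists (I :&: S); split.
- move=> x x' l l'; rewrite !inE => /andP[? _] /andP[? _] /andP[? _] /andP[? _].
  by apply: incidence_linear; rewrite inE.
- rewrite -card_incidence -(ler_nat R) natrM -(cardsID S I) natrD.
  move: cS; rewrite -[X in _ <= _ * X%:R](cardsID S) natrD /p; lra.
move=> H HIS pH; have HI : H \subset I by apply: subset_trans HIS (subsetIl _ _).
have maxP u : (#|pencil H u| <= #|F|)%N.
  exact: leq_trans (subset_leq_card (pencilS _ HI)) (card_pencil_incidence u).
have maxL u : (#|points H u| <= #|F|)%N.
  exact: leq_trans (subset_leq_card (pointsS _ HI)) (card_points_incidence u).
case: (card_projective pH maxP maxL) => [/leq_trans->//|[k [Hk Hk3 degL]]].
have [kK|Kk] := ltnP k K.
  by apply: leq_trans Hk3 (leq_trans _ KM); rewrite leq_exp2r // ltnW.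
have [->|/set0Pn[u uH]] := eqVneq H set0; first by rewrite cards0.
have sub := spanned_sub (@incidence_linear F) pH HI.
have /QS/negP[] : Q (fst @: H).
  apply/andP; split; first by apply/set0Pn; exists u.1; apply: imset_f.
  have sup : H \subset spanned I (fst @: H).
    by apply: sub_spanned => // x l /degL->; apply: leq_trans K1 Kk.
  apply: leq_trans (subset_leq_card sup); rewrite Hk leq_mul2r.
  by rewrite Kk orbT.
exact: subset_trans sub (subset_trans HIS (subsetIr _ _)).
Qed.

(** * Blow-ups and the lower bound for diameter 3 *)

Lemma card_blowup (P L : finType) t (S : {set P * L}) :
  #|[set u : (P * 'I_t) * (L * 'I_t) | (u.1.1, u.2.1) \in S]| = (#|S| * t ^ 2)%N.
Proof.
pose h (w : (P * L) * ('I_t * 'I_t)) := ((w.1.1, w.2.1), (w.1.2, w.2.2)).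
have h_inj : injective h by move=> [[x y] [i j]] [[x' y'] [i' j']] [-> -> -> ->].
rewrite -mulnn -[X in (X * X)%N]card_ord -card_prod -[#|{: _ * _}|]cardsT.
rewrite -cardsX -(card_imset _ h_inj); apply: eq_card => -[[x i] [y j]].
rewrite inE /=; apply/idP/imsetP => [xy|[[[x' y'] [i' j']]]].
  by exists ((x, y), (i, j)); rewrite // !inE xy.
by rewrite !inE andbT => xy [-> _ -> _].
Qed.

(** Common neighbours in a part of diameter 3 project to joining lines and meeting points, so the
    projection is [projective]; each of its incidences lifts to at most $t^2$ edges. *)
Lemma le_Pdiam3 (R : realType) n t (P L : finType) (eps : R)
    (S : {set P * L}) M :
  0 <= eps -> (t * (#|P| + #|L|) <= n)%N -> partial_linear S ->
  (forall H : {set P * L}, H \subset S -> projective H -> (#|H| <= M)%N) ->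
  (#|S| * t ^ 2)%:R <= eps * n%:R ^+ 2 + (Pdiam n eps 3)%:R * (M * t ^ 2)%:R.
Proof.
move=> e0 tn linS maxH; rewrite -card_blowup.
apply: le_Pdiam_bip => //; first by rewrite !card_prod card_ord; lia.
move=> f g f_inj g_inj fg H HS dH.
pose pr (u : (P * 'I_t) * (L * 'I_t)) := (u.1.1, u.2.1).
pose H' := pr @: H.
have H'S : H' \subset S.
  by apply/subsetP => _ /imsetP[u /(subsetP HS) + ->]; rewrite inE.
have prH x l : (x, l) \in H' -> exists i j, ((x, i), (l, j)) \in H.
  by case/imsetP => -[[x' i] [l' j]] uH [-> ->]; exists i, j.
have pH' : projective H'; first split.
- move=> x l x' l' /prH[i [j xl]] /prH[i' [j' xl']].
  have [[m k] xm xm'] := bip_diam3l f_inj g_inj fg dH xl xl'.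
  by exists m; apply/imsetP; [exists (x, i, (m, k))|exists (x', i', (m, k))].
- move=> x l x' l' /prH[i [j xl]] /prH[i' [j' xl']].
  have [[m k] xm xm'] := bip_diam3r f_inj g_inj fg dH xl xl'.
  by exists m; apply/imsetP; [exists (m, k, (l, j))|exists (m, k, (l', j'))].
- by move=> x x' l l' *; apply: (linS x x'); rewrite // (subsetP H'S).
apply: leq_trans (leq_mul (maxH H' H'S pH') (leqnn _)).
rewrite -card_blowup; apply/subset_leq_card/subsetP => u uH.
by rewrite inE; apply: imset_f.
Qed.

Lemma leq_18_exp2 i : (6 <= i)%N -> (18 * i.+1 <= 2 ^ i.+1)%N.
Proof.
elim: i => // i IHi; rewrite leq_eqVlt => /orP[/eqP<- //|].
by rewrite ltnS => /IHi; rewrite [(2 ^ i.+2)%N]expnS; lia.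
Qed.

(** Three factors 3/4 gain a factor 2, because $2 \cdot 3^3 \le 4^3$. *)
Lemma leq_exp3_exp4 u K : (3 * u <= K)%N -> (2 ^ u * 3 ^ K <= 4 ^ K)%N.
Proof.
have mono m k e : (m <= k -> m ^ e <= k ^ e)%N.
  by case: e => // e mk; rewrite leq_exp2r.
move=> uK; rewrite -(subnKC uK) !(expnD _ (3 * u)) mulnA leq_mul //; last exact: mono.
by rewrite !(expnM _ 3) -expnMn; apply: mono.
Qed.

Lemma Pdiam3_lower (R : realType) n d (eps : R) : (0 < n)%N -> (18 <= d)%N ->
  (Num.sqrt n%:R)^-1 <= eps -> eps <= (64 * 2 ^+ d)^-1 ->
  (32 * 128 ^+ 2)^-1 / eps ^+ 2 <= (Pdiam n eps 3)%:R.
Proof.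
move=> n0 d18 ne e1.
have n0R : 0 < n%:R :> R by rewrite ltr0n.
have sn0 : 0 < Num.sqrt n%:R :> R by rewrite sqrtr_gt0.
have e0 : 0 < eps by apply: lt_le_trans ne; rewrite invr_gt0.
have {}ne : 1 <= eps ^+ 2 * n%:R.
  have : 1 <= eps * Num.sqrt n%:R by rewrite -ler_pdivrMr // div1r.
  move=> H; rewrite -[n%:R](@sqr_sqrtr R) ?ler0n // -exprMn.
  by rewrite exprn_ege1.
have {}e1 : 2 ^+ d <= (64 * eps)^-1.
  have d0 : 0 < 2 ^+ d :> R by rewrite exprn_gt0.
  rewrite -[leRHS]div1r ler_pdivlMr ?mulr_gt0 //.
  by move: e1; rewrite -[leRHS]div1r ler_pdivlMr ?mulr_gt0 //; lra.
have x0 : 0 <= (64 * eps)^-1 by apply: le_trans e1; rewrite exprn_ge0.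
pose m := Num.truncn ((64 * eps)^-1).
have m18 : (2 ^ d <= m)%N by rewrite truncn_ge_nat // natrX.
have m_gt0 : (0 < m)%N by apply: leq_trans m18; rewrite expn_gt0.
pose j := trunc_log 2 m; have /andP[jm mj] := trunc_log_bounds (isT : (1 < 2)%N) m_gt0.
have j18 : (18 <= j)%N.
  apply: leq_trans d18 _.
  by rewrite -ltnS -(ltn_exp2l _ _ (isT : (1 < 2)%N)); apply: leq_ltn_trans m18 mj.
have [F _ cardF] := pPrimePowerField (isT : prime 2) (leq_trans (isT : (0 < 18)%N) j18).
(* [q] is the largest power of 2 up to $1/(64\epsilon)$, so $1/128 < \epsilon q \le 1/64$. [K] is of
   order $q^{1/3}$, with $K^3 \le 8q$; as [i] is at least 6, $(3/4)^K \le 2^{-6(i+1)} \le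
   1/(4q^2)$. *)
pose i := (j %/ 3)%N; pose K := (2 ^ i.+1)%N; pose q := (2 ^ j)%N.
have i6 : (6 <= i)%N by rewrite leq_divRL.
have ij : (3 * i <= j)%N by rewrite mulnC leq_divM.
have ji : (j <= 3 * i + 2)%N by lia.
have q0 : (0 < q)%N by rewrite expn_gt0.
have K1 : (1 < K)%N by rewrite -[1%N](expn0 2) ltn_exp2l.
have K3 : (K ^ 3 <= 8 * q)%N.
  by rewrite -expnM -[8%N]/(2 ^ 3)%N -expnD leq_exp2l //; lia.
have qK : 4 * #|F|%:R ^+ 2 * (3 / 4) ^+ K <= 1 :> R.
  rewrite cardF expr_div_n mulrA ler_pdivrMr ?exprn_gt0 // mul1r.
  rewrite -!natrX -!natrM ler_nat.
  have H : (3 * (6 * i.+1) <= K)%N by rewrite mulnA leq_18_exp2.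
  apply: leq_trans (leq_exp3_exp4 H); rewrite leq_mul2r; apply/orP; right.
  by rewrite -expnM -[4%N]/(2 ^ 2)%N -expnD leq_exp2l //; lia.
have qM : (4 * #|F| <= 8 * q)%N by rewrite cardF -/q leq_mul2r orbT.
have [S [linS cS maxH]] := exists_planeless K1 qM K3 qK.
rewrite -/q in cardF; rewrite cardF in cS.
have qm : q%:R <= (64 * eps)^-1.
  by apply: le_trans (_ : m%:R <= _); rewrite ?ler_nat // truncn_le.
have mq : (64 * eps)^-1 < 2 * q%:R.
  have /andP[_ /lt_le_trans] := truncn_itv x0; apply.
  by rewrite -natrM ler_nat -expnS.
have {}qm : 64 * (eps * q%:R) <= 1.
  by rewrite mulrA -[leRHS](mulfV (_ : 64 * eps != 0)) ?gt_eqF ?mulr_gt0 //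
             ler_wpM2l // ltW // mulr_gt0.
have {}mq : 1 < 128 * (eps * q%:R).
  rewrite -(ltr_pM2l (_ : 0 < 64 * eps)) ?mulr_gt0 // in mq.
  by rewrite mulfV ?gt_eqF ?mulr_gt0 // in mq; lra.
move: q cardF q0 {K3} qM maxH cS qm mq => q cardF q0 qM maxH cS qm mq.
pose t := (n %/ (2 * q ^ 2))%N.
have qn : (2 * q ^ 2 <= n)%N.
  rewrite -(ler_nat R) natrM natrX.
  rewrite -(ler_pM2l (exprn_gt0 2 e0)); apply: le_trans ne.
  have : (64 * (eps * q%:R)) ^+ 2 <= 1.
    by rewrite expr_le1 // !mulr_ge0 // ltW.
  by have := sqr_ge0 (eps * q%:R); rewrite !exprMn; lra.
have t0 : (0 < t)%N by rewrite divn_gt0 // muln_gt0 expn_gt0 q0.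
have tn : (t * (#|{: F * F}| + #|{: F * F}|) <= n)%N.
  rewrite card_prod cardF addnn -mul2n mulnn; exact: leq_divM.
have nt : (n <= 4 * (t * q ^ 2))%N.
  have : (n < t.+1 * (2 * q ^ 2))%N by rewrite -ltn_divLR // muln_gt0 expn_gt0 q0.
  by nia.
have := le_Pdiam3 (ltW e0) tn linS maxH; rewrite !(natrX, natrM).
move: cS nt t0 q0; rewrite -!(ler_nat R) !(natrX, natrM).
move: q%:R t%:R #|S|%:R n%:R n0R (Pdiam _ _ _)%:R qm mq.
move=> v T s w w0 P qm mq sv wT T1 v1 le_P.
have T2 : 0 < T ^+ 2 by rewrite exprn_gt0 //; lra.
have v2 : 0 < v ^+ 2 by rewrite exprn_gt0 //; lra.
have h1 : w ^+ 2 <= (4 * (T * v ^+ 2)) ^+ 2.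
  by rewrite ler_sqr ?nnegrE ?mulr_ge0 //; lra.
have h2 : eps * w ^+ 2 <= eps * (4 * (T * v ^+ 2)) ^+ 2 by rewrite ler_wpM2l // ltW.
have h3 : 0 <= T ^+ 2 * (v ^+ 2 * v) * (1 - 64 * (eps * v)).
  by rewrite !mulr_ge0 ?subr_ge0 ?(ltW T2) ?(ltW v2) //; lra.
have h4 : 0 <= T ^+ 2 * (2 * s - v ^+ 3) by rewrite mulr_ge0 ?subr_ge0 ?(ltW T2).
(* Here [v], [T], [w] stand for $q$, $t$, $n$. The graph has at least $v^3T^2/2$ edges, the
   exceptional part at most $16\epsilon v^4T^2 \le v^3T^2/4$, and every other part at most
   $8vT^2$. *)
have vP : v ^+ 2 <= 32 * P.
  rewrite -(ler_pM2l (_ : 0 < T ^+ 2 * v)); last by rewrite mulr_gt0 //; lra.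
  by lra.
have h5 : 1 <= (128 * (eps * v)) ^+ 2 by rewrite exprn_ege1 // ltW.
have e2 : 0 < eps ^+ 2 by rewrite exprn_gt0.
rewrite ler_pdivrMr // -[leLHS]div1r ler_pdivrMr ?mulr_gt0 ?exprn_gt0 //.
have h6 : 0 <= eps ^+ 2 * (32 * P - v ^+ 2) by rewrite mulr_ge0 ?subr_ge0 // ltW.
by rewrite !exprMn in h5; lra.
Qed.

(** * The theorem *)

Theorem theorem1p2 (R : realType) :
  (* (a) *)
  (forall eta : R, 0 < eta ->
     exists c C : R, [/\ 0 < c, 0 < C &
       exists N : nat, forall n : nat, (N <= n)%N ->
         forall eps : R, 0 <= eps -> eps <= 1 / 4 - eta ->
           c * n%:R <= (Pdiam n eps 2)%:R /\
           (Pdiam n eps 2)%:R <= C * n%:R])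
  /\
  (* (b) *)
  (exists eps0 c C : R, [/\ 0 < eps0, 0 < c, 0 < C &
     forall (n : nat) (eps : R), (0 < n)%N ->
       (Num.sqrt n%:R)^-1 <= eps -> eps <= eps0 ->
         c / eps ^+ 2 <= (Pdiam n eps 3)%:R /\
         (Pdiam n eps 3)%:R <= C / eps ^+ 2])
  /\
  (* (c) *)
  (exists eps0 c C : R, [/\ 0 < eps0, 0 < c, 0 < C &
     forall (n : nat) (eps : R), (0 < n)%N ->
       n%:R^-1 <= eps -> eps <= eps0 ->
         c / eps <= (Pdiam n eps 4)%:R /\
         (Pdiam n eps 4)%:R <= C / eps]).
Proof.
split; first exact: Pdiam2_linear.
split.
  (* This threshold makes $1/(64\epsilon)$ at least $2^{18}$, hence also the order of the field. *)
  exists (64 * 2 ^+ 18)^-1, (32 * 128 ^+ 2)^-1, 2; split=> //.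
  - by rewrite invr_gt0 mulr_gt0 // exprn_gt0.
  - by rewrite invr_gt0 mulr_gt0 // exprn_gt0.
  move=> n eps n0 ne e1; split; first exact: Pdiam3_lower ne e1.
  apply: Pdiam3_upper; first by apply: lt_le_trans ne; rewrite invr_gt0 sqrtr_gt0 ltr0n.
  apply: le_trans e1 _; rewrite invf_le1 ?mulr_gt0 ?exprn_gt0 //.
  by rewrite mulr_ege1 ?exprn_ege1 ?ler1n.
exists 18^-1, 72^-1, 2; split; rewrite ?invr_gt0 //.
move=> n eps n0 ne e1; split; first exact: Pdiam4_lower ne e1.
apply: Pdiam4_upper; first by apply: lt_le_trans ne; rewrite invr_gt0 ltr0n.
by apply: le_trans e1 _; lra.
Qed.
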